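(* Let $n\ge1$ be an integer, let $\lambda=2^{-\frac1n}$, and let $\mathcal S_\lambda=\{\phi_{-1},\phi_1\}$ be the iterated function system on $\mathbb R$ given by $\phi_{-1}(x)=\lambda x-1$, $\phi_1(x)=\lambda x+1$, with limit set $\Lambda$. Then the topological overlap number is $o(\mathcal S_\lambda)=\sqrt[n]{2^{n-1}}$, and the measure $\pi_{2*}\mu_{max}$ is absolutely continuous with respect to Lebesgue measure.
   Context: Let $\mathcal S=\{\phi_i, i\in I\}$ be a finite iterated function system of injective conformal contractions, with limit set $\Lambda$ (the unique nonempty compact set with $\Lambda=\bigcup_{i\in I}\phi_i(\Lambda)$), and write $\phi_{i_1\ldots i_p}=\phi_{i_1}\circ\cdots\circ\phi_{i_p}$. For $\mathcal S_\lambda$, $I=\{-1,1\}$ and $\Lambda=[-\frac1{1-\lambda},\frac1{1-\lambda}]$. Let $\Sigma_I^+=\{\omega=(\omega_1,\omega_2,\ldots):\omega_i\in I\}$ with the shift $\sigma$, and let $\Phi:\Sigma_I^+\times\Lambda\to\Sigma_I^+\times\Lambda$, $\Phi(\omega,x)=(\sigma\omega,\phi_{\omega_1}(x))$, be the lift of $\mathcal S$. Let $\mu_{max}$ be the measure of maximal entropy of $\Phi$ (the equilibrium measure of the zero potential), and $\pi_2:\Sigma_I^+\times\Lambda\to\Lambda$ the second projection. The topological overlap number $o(\mathcal S)$ is the overlap number of $\mu_{max}$, namely $$o(\mathcal S)=\exp\Big(\lim_{k\to\infty}\frac1k\int_{\Sigma_I^+\times\Lambda}\log \mathrm{Card}\{(\eta_1,\ldots,\eta_k)\in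 I^k:\ \exists y\in\Lambda,\ \phi_{\omega_k\ldots\omega_1}(x)=\phi_{\eta_k\ldots\eta_1}(y)\}\,d\mu_{max}(\omega,x)\Big).$$ It is known that the limit exists and that, equivalently, $o(\mathcal S)=\exp\big(\lim_{k\to\infty}\frac1k\int_{\Sigma_I^+}\log\beta_k(\pi\omega)\,d\mu_{max}^+(\omega)\big)$, where $\beta_k(x)=\mathrm{Card}\{(\eta_1,\ldots,\eta_k)\in I^k: x\in\phi_{\eta_1\ldots\eta_k}(\Lambda)\}$, $\pi:\Sigma_I^+\to\Lambda$, $\pi(\omega)=\phi_{\omega_1\omega_2\ldots}:=\lim_{p\to\infty}\phi_{\omega_1\ldots\omega_p}(z)$ (for any $z\in\Lambda$) is the canonical projection, and $\mu_{max}^+$ is the Bernoulli measure on $\Sigma_I^+$ with weights $(\frac1{|I|},\ldots,\frac1{|I|})$. *)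

(* Defs.v *)
From HB Require Import structures.
From mathcomp Require Import all_boot all_order all_algebra.
From mathcomp Require Import all_classical all_reals all_analysis.

Set Implicit Arguments.
Unset Strict Implicit.
Unset Printing Implicit Defensive.

Import Order.TTheory GRing.Theory Num.Theory.
Import numFieldNormedType.Exports.

Local Open Scope classical_set_scope.
Local Open Scope ring_scope.

(* A system lives on a measurable subset [X] of an ambient measurable type [T];
Borel probability measures on [X] are the probability measures [mu] on [T] such
that [mu X = 1].  A finite measurable partition is given by the function sending
a point to the index of its cell (some cells may be empty). *)

Section entropy.
Context {d : measure_display} {T : measurableType d} {R : realType}.
Implicit Types (f : T -> T) (X : set T) (mu : probability T R).

Definition finite_partition (m : nat) (P : T -> 'I_m) : Prop :=
  forall i : 'I_m, measurable (P @^-1` [set i]).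

(* The cell of the join of P, f^-1 P, ..., f^-(k-1) P with itinerary a. *)
Definition join_cell f (m : nat) (P : T -> 'I_m) (k : nat)
    (a : k.-tuple 'I_m) : set T :=
  [set x | forall j : 'I_k, P (iter j f x) = tnth a j].

(* Since ln 0 = 0, cells of measure zero contribute 0. *)
Definition join_entropy f mu (m : nat) (P : T -> 'I_m) (k : nat) : R :=
  - \sum_(a : k.-tuple 'I_m)
      fine (mu (join_cell f P a)) * ln (fine (mu (join_cell f P a))).

(* For an invariant mu the sequence converges, by subadditivity. *)
Definition partition_entropy f mu (m : nat) (P : T -> 'I_m) : R :=
  limn (fun k : nat => k%:R^-1 * join_entropy f mu P k).

Definition measure_entropy f mu : \bar R :=
  ereal_sup [set h | exists (m : nat) (P : T -> 'I_m),
    finite_partition P /\ h = (partition_entropy f mu P)%:E].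

Definition invariant_probability f X mu : Prop :=
  mu X = 1%E /\ forall A, measurable A -> pushforward mu f A = mu A.

Definition max_entropy_measure f X mu : Prop :=
  invariant_probability f X mu /\
  forall nu, invariant_probability f X nu ->
    (measure_entropy f nu <= measure_entropy f mu)%E.

End entropy.

(* The symbols -1 and 1 are [false] and [true], and the entry w_(i+1) of a sequence
w is [w i].  The sigma-algebra generated by the coordinates is the Borel
sigma-algebra of the product topology. *)

Definition coordinate_sets : set (set (nat -> bool)) :=
  [set A | exists (i : nat) (b : bool), A = [set w | w i = b]].

Notation shift_space := (g_sigma_algebraType coordinate_sets).

Definition shift (w : shift_space) : shift_space := fun i => w i.+1.

Section ifs.
Context {R : realType}.
Implicit Types (phi : bool -> R -> R) (Lambda : set R).

Definition limit_set phi Lambda : Prop :=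
  [/\ compact Lambda, Lambda !=set0 &
      Lambda = \bigcup_(i in [set: bool]) (phi i @` Lambda)].

(* phi_(i1 ... ip) = phi_i1 \o ... \o phi_ip *)
Definition phi_word phi (s : seq bool) (x : R) : R := foldr phi x s.

Definition lift_map phi (p : shift_space * measurableTypeR R) :
    shift_space * measurableTypeR R :=
  (shift p.1, phi (p.1 0%N) p.2).

Definition lift_space Lambda : set (shift_space * measurableTypeR R) :=
  [set: shift_space] `*` Lambda.

(* mkseq w k = [:: w_1; ...; w_k]; the finite words are reversed to get the
   compositions phi_(w_k ... w_1) and phi_(eta_k ... eta_1). *)
Definition overlap_count phi Lambda (k : nat) (w : shift_space) (x : R) : nat :=
  #|[set eta : k.-tuple bool | `[< exists2 y, Lambda y &
       phi_word phi (rev (mkseq w k)) x = phi_word phi (rev eta) y >]]|.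

Definition overlap_average phi Lambda
    (mu : probability (shift_space * measurableTypeR R)%type R) (k : nat) : R :=
  k%:R^-1 *
  \int[mu]_(p in lift_space Lambda) ln (overlap_count phi Lambda k p.1 p.2)%:R.

Definition overlap_number phi Lambda
    (mu : probability (shift_space * measurableTypeR R)%type R) : R :=
  expR (limn (overlap_average phi Lambda mu)).

Definition bernoulli_ifs (lambda : R) (i : bool) (x : R) : R :=
  if i then lambda * x + 1 else lambda * x - 1.

End ifs.

(* Main.v *)
(* The entropy of [Phi] with respect to an invariant measure is carried by the
symbolic coordinate: along a fixed word the fibre maps are monotone, so the orbit of
a point visits the cells of a partition of the line into intervals in only linearly
many ways.  The product of the Bernoulli(1/2, 1/2) measure with the law of
[sum_j +- lambda^j] is invariant of entropy [ln 2], and subadditivity then forces the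
symbolic marginal of a measure of maximal entropy to give mass [2^-l] to every
cylinder of length [l].

Since [lambda^n = 1/2], among the terms of [sum_(j < n m) +- lambda^j] those with [n]
dividing [j] form an arithmetic progression of step [4 * 2^-m].  Hence at most
[2^(nm-m) (|J| 2^m / 4 + 1)] sign sequences have their sum in an interval [J], and
because the contractions make the second coordinate depend only on the past letters,
[mu(omega in [eta], phi_(omega_k ... omega_1)(x) in A) <= |A| / (4 (2 lambda)^k)]
for every word [eta] of length [k].  The case [k = 0] is absolute continuity.  The
same count bounds the number of overlaps by [C (2 lambda)^k], while the displayed
inequality bounds the integral of its inverse by [C' (2 lambda)^-k], so that the
averages converge to [ln (2 lambda) = (1 - 1/n) ln 2]. *)
From HB Require Import structures.
Require Import Defs.
From mathcomp Require Import all_boot all_order all_algebra.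
From mathcomp Require Import all_classical all_reals all_analysis.
From mathcomp Require Import measurable_realfun.
From mathcomp Require Import ring lra.
Import Order.TTheory GRing.Theory Num.Theory.
Import numFieldNormedType.Exports.
Local Open Scope classical_set_scope.
Local Open Scope ring_scope.

Set Implicit Arguments.
Unset Strict Implicit.
Unset Printing Implicit Defensive.

(** * Entropy of finitely valued random variables *)

Section discrete_entropy.
Context d (T : measurableType d) (R : realType) (mu : probability T R).

Definition prob (A : set T) : R := fine (mu A).

Lemma probE (A : set T) : measurable A -> (prob A)%:E = mu A.
Proof. by move=> mA; rewrite /prob fineK// fin_num_measure. Qed.

Lemma prob_ge0 (A : set T) : 0 <= prob A.
Proof. exact: fine_ge0. Qed.

Lemma probT : prob setT = 1.
Proof. by rewrite /prob probability_setT. Qed.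

Lemma le_prob (A B : set T) : measurable A -> measurable B -> A `<=` B ->
  prob A <= prob B.
Proof.
by move=> mA mB AB; rewrite -lee_fin !probE// le_measure// inE.
Qed.

Lemma prob_le1 (A : set T) : measurable A -> prob A <= 1.
Proof. by move=> mA; rewrite -probT le_prob. Qed.

Lemma prob_setU_le (A B : set T) : measurable A -> measurable B ->
  prob (A `|` B) <= prob A + prob B.
Proof.
move=> mA mB; rewrite -lee_fin EFinD !probE//; first exact: measureU2.
exact: measurableU.
Qed.

Lemma prob_bigsetU_le (J : finType) (A : J -> set T) :
  (forall j, measurable (A j)) ->
  prob (\big[setU/set0]_j A j) <= \sum_j prob (A j).
Proof.
move=> mA; suff [] : measurable (\big[setU/set0]_j A j) /\
  prob (\big[setU/set0]_j A j) <= \sum_j prob (A j) by [].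
elim/big_rec2: _ => [|j s B _ [mB Bs]]; first by rewrite /prob measure0.
split; first exact: measurableU.
by rewrite (le_trans (prob_setU_le _ _))// lerD2l.
Qed.

Definition discrete_rv (F : finType) (X : T -> F) : Prop :=
  forall a, measurable (X @^-1` [set a]).

Definition law (F : finType) (X : T -> F) (a : F) : R := prob (X @^-1` [set a]).

Definition ent (F : finType) (X : T -> F) : R :=
  - \sum_a law X a * ln (law X a).

Lemma discrete_rv_preimage (F : finType) (X : T -> F) (B : set F) :
  discrete_rv X -> measurable (X @^-1` B).
Proof.
move=> mX; have -> : X @^-1` B = \bigcup_(a in B) X @^-1` [set a].
  apply/seteqP; split=> [x Bx|x [a Ba] /= ->//]; by exists (X x).
by apply: fin_bigcup_measurable => [|a _]; [exact: finite_finset|exact: mX].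
Qed.

Lemma discrete_rv_comp (F G : finType) (g : F -> G) (X : T -> F) :
  discrete_rv X -> discrete_rv (g \o X).
Proof. by move=> mX a; exact: (@discrete_rv_preimage _ _ (g @^-1` [set a])). Qed.

Lemma discrete_rv_pair (F G : finType) (X : T -> F) (Y : T -> G) :
  discrete_rv X -> discrete_rv Y -> discrete_rv (fun t => (X t, Y t)).
Proof.
move=> mX mY [a b].
have -> : (fun t => (X t, Y t)) @^-1` [set (a, b)] =
    X @^-1` [set a] `&` Y @^-1` [set b].
  by apply/seteqP; split=> t /= [-> ->].
by apply: measurableI; [exact: mX|exact: mY].
Qed.

Lemma discrete_rv_ffun (J F : finType) (X : J -> T -> F) :
  (forall j, discrete_rv (X j)) -> discrete_rv (fun t => [ffun j => X j t]).
Proof.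
move=> mX a.
have -> : (fun t => [ffun j => X j t]) @^-1` [set a] =
    \bigcap_(j in [set: J]) X j @^-1` [set a j].
  apply/seteqP; split=> [t /= <- j _ /=|t /= h]; first by rewrite ffunE.
  by apply/ffunP => j; rewrite ffunE; exact: h.
by apply: fin_bigcap_measurable => [|j _]; [exact: finite_finset|exact: mX].
Qed.

Lemma discrete_rv_bool (B : T -> bool) : measurable [set t | B t] -> discrete_rv B.
Proof.
move=> mB [].
  by have -> : B @^-1` [set true] = [set t | B t] by apply/seteqP; split.
have -> : B @^-1` [set false] = ~` [set t | B t].
  by apply/seteqP; split=> t /=; case: (B t).
exact: measurableC.
Qed.

(** Stated for an arbitrary measure because it serves both the laws of random variables and, for the
    cells of the overlap count, Lebesgue measure. *)
Lemma measure_preimage (m : {measure set T -> \bar R}) (F : finType) (X : T -> F)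
    (B : pred F) : discrete_rv X ->
  m (X @^-1` [set a | B a]) = (\sum_(a | B a) m (X @^-1` [set a]))%E.
Proof.
move=> mX.
have -> : X @^-1` [set a | B a] = \bigcup_(a in [set a | B a]) X @^-1` [set a].
  apply/seteqP; split=> [x Bx|x [a Ba] /= ->//]; by exists (X x).
have tX : trivIset [set a | B a] (fun a => X @^-1` [set a]).
  by move=> a b _ _ [t [/= <- <-]].
rewrite measure_fin_bigcup//; [|exact: finite_finset].
rewrite (fsbigE (enum B)) ?enum_uniq//; first last.
- by move=> a /= Ba; rewrite mem_enum -topredE/= Ba.
- by move=> a /=; rewrite mem_enum.
rewrite big_enum_cond; apply: eq_bigl => a.
rewrite -!topredE/=; apply/andP/idP => [[]//|Ba]; split=> //.
exact/asboolP.
Qed.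

Lemma prob_preimage (F : finType) (X : T -> F) (B : pred F) :
  discrete_rv X -> prob (X @^-1` [set a | B a]) = \sum_(a | B a) law X a.
Proof.
move=> mX; apply: EFin_inj; rewrite probE; last exact: discrete_rv_preimage.
rewrite measure_preimage// -sumEFin.
by apply: eq_bigr => a _; rewrite probE.
Qed.

Lemma law_ge0 (F : finType) (X : T -> F) a : 0 <= law X a.
Proof. exact: prob_ge0. Qed.

Lemma law_sum1 (F : finType) (X : T -> F) : discrete_rv X -> \sum_a law X a = 1.
Proof.
move=> mX; rewrite -(@prob_preimage _ _ predT)//.
by rewrite -[RHS]probT; congr prob; apply/seteqP.
Qed.

Lemma law_comp (F G : finType) (g : F -> G) (X : T -> F) b :
  discrete_rv X -> law (g \o X) b = \sum_(a | g a == b) law X a.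
Proof.
move=> mX; rewrite -(@prob_preimage _ _ (fun a => g a == b))//.
by congr prob; apply/seteqP; split=> t /= /eqP.
Qed.

Lemma law_fst (F G : finType) (X : T -> F) (Y : T -> G) a :
  discrete_rv X -> discrete_rv Y ->
  law X a = \sum_b law (fun t => (X t, Y t)) (a, b).
Proof.
move=> mX mY; have := discrete_rv_pair mX mY.
move/(fun h => @law_comp _ _ fst _ a h); rewrite [X in X = _]/=.
have -> : (fst \o (fun t => (X t, Y t))) = X by [].
move=> ->; rewrite (partition_big snd xpredT)//=; apply: eq_bigr => b _.
by rewrite (big_pred1 (a, b)).
Qed.

Lemma law_snd (F G : finType) (X : T -> F) (Y : T -> G) b :
  discrete_rv X -> discrete_rv Y ->
  law Y b = \sum_a law (fun t => (X t, Y t)) (a, b).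
Proof.
move=> mX mY; rewrite (@law_fst _ _ _ X)//; apply: eq_bigr => a _.
by congr prob; apply/seteqP; split=> t /= [-> ->].
Qed.

(** This is [ln x <= x - 1] at [x = q / p], multiplied by [p]; for [p = 0] the left side
    vanishes. *)
Lemma ln_gibbs (p q : R) : 0 <= p -> 0 <= q -> (0 < p -> 0 < q) ->
  p * ln q - p * ln p <= q - p.
Proof.
rewrite le_eqVlt => /predU1P[<- q0 _|p0 _ /(_ p0) q0].
  by rewrite !mul0r !subr0.
rewrite -mulrBr -ln_div ?posrE//.
have h : ln (q / p) <= q / p - 1.
  have := @le_ln1Dx R (q / p - 1); rewrite addrCA subrr addr0; apply.
  by rewrite ltrBDl addrN divr_gt0.
apply: (le_trans (ler_wpM2l (ltW p0) h)).
by rewrite mulrBr mulr1 mulrCA divff ?mulr1// gt_eqF.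
Qed.

(** [ln_gibbs] summed over the values. Positivity of [q] on the support matters: with [ln 0 = 0], an
    atom missed by [q] would be charged nothing. *)
Lemma cross_entropy (F : finType) (X : T -> F) (q : F -> R) :
  discrete_rv X -> (forall a, 0 <= q a) -> \sum_a q a <= 1 ->
  (forall a, 0 < law X a -> 0 < q a) ->
  ent X <= - \sum_a law X a * ln (q a).
Proof.
move=> mX q0 q1 Xq; rewrite lerN2 -subr_le0 -sumrB.
apply: (@le_trans _ _ (\sum_a (q a - law X a))).
  by apply: ler_sum => a _; apply: ln_gibbs => //; [exact: law_ge0|exact: Xq].
by rewrite sumrB law_sum1// subr_le0.
Qed.

Lemma ent_ge0 (F : finType) (X : T -> F) : discrete_rv X -> 0 <= ent X.
Proof.
move=> mX; rewrite oppr_ge0 sumr_le0// => a _.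
by rewrite mulr_ge0_le0 ?law_ge0// ln_le0// prob_le1.
Qed.

(** Each atom of [X] has at most the mass of the atom of [g \o X] containing it, and [ln] is
    increasing. *)
Lemma ent_comp (F G : finType) (g : F -> G) (X : T -> F) :
  discrete_rv X -> ent (g \o X) <= ent X.
Proof.
move=> mX; rewrite lerN2.
have -> : \sum_b law (g \o X) b * ln (law (g \o X) b) =
    \sum_a law X a * ln (law (g \o X) (g a)).
  rewrite (partition_big g xpredT)//=; apply: eq_bigr => b _.
  rewrite {1}law_comp// mulr_suml; apply: eq_bigr => a /eqP <-//.
apply: ler_sum => a _; have := law_ge0 X a.
rewrite le_eqVlt => /predU1P[<-|a0]; first by rewrite !mul0r.
have le_a : law X a <= law (g \o X) (g a).
  rewrite law_comp// (bigD1 a)//= lerDl sumr_ge0// => *; exact: law_ge0.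
rewrite ler_wpM2l ?law_ge0// ler_ln ?posrE//.
exact: lt_le_trans le_a.
Qed.

Lemma ent_le_ln_card (F : finType) (X : T -> F) : discrete_rv X ->
  ent X <= ln #|F|%:R.
Proof.
move=> mX; have [F0|F0] := posnP #|F|.
  by rewrite /ent big1 ?oppr0 ?F0 ?ln0// => a; have := card0_eq F0 a.
have F0R : 0 < #|F|%:R :> R by rewrite ltr0n.
have := @cross_entropy _ _ (fun=> #|F|%:R^-1) mX.
rewrite -mulr_suml law_sum1// lnV ?posrE// mul1r opprK; apply => //.
- by rewrite sumr_const -[_^-1 *+ _]mulr_natr mulVf// gt_eqF.
- by move=> _ _; rewrite invr_gt0.
Qed.

(** The equality case of Gibbs' inequality: the slacks [D] against the uniform weights are
    nonnegative with sum zero, hence all zero, and [ln x < x - 1] unless [x = 1]. *)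
Lemma ent_uniform (F : finType) (X : T -> F) (a : F) : discrete_rv X ->
  ent X = ln #|F|%:R -> law X a = #|F|%:R^-1.
Proof.
move=> mX HX.
have F0 : 0 < #|F|%:R :> R by rewrite ltr0n; apply/card_gt0P; exists a.
set c : R := #|F|%:R^-1; have c0 : 0 < c by rewrite invr_gt0.
pose D b := (c - law X b) - (law X b * ln c - law X b * ln (law X b)).
have D0 b : 0 <= D b.
  by rewrite subr_ge0; apply: ln_gibbs => //; [exact: law_ge0|exact: ltW].
have sD : \sum_b D b = 0.
  rewrite !sumrB law_sum1// -mulr_suml law_sum1//.
  rewrite sumr_const -[c *+ _]mulr_natr mulVf ?gt_eqF// subrr sub0r mul1r.
  by rewrite opprB -[X in X - _]opprK -/(ent X) HX lnV ?posrE//; lra.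
have /eqP : D a = 0.
  apply/eqP; rewrite eq_le D0 andbT -sD (bigD1 a)//= lerDl sumr_ge0//.
rewrite /D.
have := law_ge0 X a; rewrite le_eqVlt => /predU1P[<-|].
  by rewrite !mul0r !subr0 gt_eqF.
set p := law X a => p0.
rewrite -mulrBr -ln_div ?posrE// subr_eq0 => /eqP pE.
apply/eqP; rewrite eq_sym -subr_eq0; apply/eqP.
apply: contrapT => /eqP cp.
have h : ln (c / p) < c / p - 1.
  rewrite -ltr_expR lnK ?posrE ?divr_gt0//.
  rewrite -[X in X < _](addrNK 1) addrC.
  apply: expR_gt1Dx.
  apply: contra cp => /eqP/subr0_eq cp1.
  apply/eqP; rewrite -[0](subrr p); congr (_ - _).
  by rewrite -[RHS]mul1r -cp1 divfK// gt_eqF.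
have := h; rewrite -(ltr_pM2l p0) -pE mulrBr mulr1 mulrCA divff ?gt_eqF//.
by rewrite mulr1 ltxx.
Qed.

(** Gibbs' inequality against the product of the two marginals. *)
Lemma ent_pair (F G : finType) (X : T -> F) (Y : T -> G) :
  discrete_rv X -> discrete_rv Y ->
  ent (fun t => (X t, Y t)) <= ent X + ent Y.
Proof.
move=> mX mY; have mXY := discrete_rv_pair mX mY.
have leX a b : law (fun t => (X t, Y t)) (a, b) <= law X a.
  rewrite (@law_fst _ _ X Y)// (bigD1 b)//= lerDl sumr_ge0// => *.
  exact: law_ge0.
have leY a b : law (fun t => (X t, Y t)) (a, b) <= law Y b.
  rewrite (@law_snd _ _ X Y)// (bigD1 a)//= lerDl sumr_ge0// => *.
  exact: law_ge0.
have := @cross_entropy _ _ (fun p => law X p.1 * law Y p.2) mXY.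
set s := (X in _ <= - X); move=> h.
have -> : ent X + ent Y = - s; last first.
  apply: h => [[a b]||[a b] ab0] /=; first by rewrite mulr_ge0// law_ge0.
    rewrite -(pair_bigA _ (fun a b => law X a * law Y b))/=.
    under eq_bigr do rewrite -mulr_sumr law_sum1// mulr1.
    by rewrite law_sum1.
  by rewrite mulr_gt0// (lt_le_trans ab0).
rewrite /ent -opprD; congr (- _).
have -> : s = \sum_a \sum_b law (fun t => (X t, Y t)) (a, b) *
    (ln (law X a) + ln (law Y b)).
  rewrite pair_bigA/=; apply: eq_bigr => -[a b] _ /=.
  have := law_ge0 (fun t => (X t, Y t)) (a, b).
  rewrite le_eqVlt => /predU1P[<-|ab0]; first by rewrite !mul0r.
  by rewrite lnM// posrE (lt_le_trans ab0).
under [in RHS]eq_bigr do (under eq_bigr do rewrite mulrDr; rewrite big_split/=).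
rewrite big_split/=; congr +%R.
  by apply: eq_bigr => a _; rewrite -mulr_suml -law_fst.
by rewrite exchange_big/=; apply: eq_bigr => b _; rewrite -mulr_suml -law_snd.
Qed.

Lemma ln_prod (J : finType) (f : J -> R) : (forall j, 0 < f j) ->
  ln (\prod_j f j) = \sum_j ln (f j).
Proof.
move=> f0; have [] // : 0 < \prod_j f j /\ ln (\prod_j f j) = \sum_j ln (f j).
elim/big_rec2: _ => [|j x y _ [y0 <-]]; first by rewrite ltr01 ln1.
by rewrite mulr_gt0// lnM ?posrE.
Qed.

(* Gibbs' inequality against the kernel that, given [Z], keeps each letter of [g Z] with
probability [1 - e], independently. *)
Lemma ent_fano (k m : nat) (F : finType) (X : T -> {ffun 'I_k -> 'I_m})
    (Z : T -> F) (g : F -> {ffun 'I_k -> 'I_m}) (e dl : R) :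
  (0 < m)%N -> 0 < e < 1 ->
  discrete_rv X -> discrete_rv Z ->
  (forall j, prob [set t | X t j <> g (Z t) j] <= dl) ->
  ent X <= ent Z + k%:R * (dl * ln (m%:R / e) - ln (1 - e)).
Proof.
move=> m0 /andP[e0 e1] mX mZ Hdl.
have m0R : 0 < m%:R :> R by rewrite ltr0n.
have e10 : 0 < 1 - e by rewrite subr_gt0.
(* A row sums to [1 - e + (m - 1) * e / m], which is below 1; [cross_entropy] accepts such
   sub-probability weights. *)
pose r (i i' : 'I_m) : R := if i == i' then 1 - e else e / m%:R.
have r0 i i' : 0 < r i i' by rewrite /r; case: ifP => // _; rewrite divr_gt0.
have r1 i' : \sum_i r i i' <= 1.
  rewrite (bigD1 i')//= {1}/r eqxx.
  rewrite -[X in _ <= X](subrK e) lerD2l.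
  rewrite (eq_bigr (fun=> e / m%:R)); last by move=> i /negbTE; rewrite /r => ->.
  apply: (@le_trans _ _ (\sum_(i : 'I_m) e / m%:R)).
    by rewrite [leRHS](bigD1 i')//= lerDr divr_ge0// ltW.
  by rewrite sumr_const card_ord -[e / _ *+ _]mulr_natr divfK// gt_eqF.
have lnme : 0 <= ln (m%:R / e).
  by rewrite ln_ge0// ler_pdivlMr// mul1r (le_trans (ltW e1))// ler1n.
(* The cost [- ln (1 - e)] is charged to every letter, right or wrong, so only the term with
   [ln (m / e)] depends on the error. *)
have lr i i' : - ln (r i i') <= - ln (1 - e) + (i != i')%:R * ln (m%:R / e).
  rewrite /r; case: eqP => _; first by rewrite mul0r addr0.
  rewrite mul1r -lnV ?posrE ?divr_gt0// invf_div lerDr.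
  by rewrite oppr_ge0 ln_le0// lerBlDr lerDl ltW.
have mXZ := discrete_rv_pair mX mZ.
pose q (p : {ffun 'I_k -> 'I_m} * F) := law Z p.2 * \prod_j r (p.1 j) (g p.2 j).
have leZ a b : law (fun t => (X t, Z t)) (a, b) <= law Z b.
  rewrite (@law_snd _ _ X Z)// (bigD1 a)//= lerDl sumr_ge0// => *.
  exact: law_ge0.
have pr0 (a : {ffun 'I_k -> 'I_m}) b : 0 < \prod_j r (a j) (g b j).
  by apply: prodr_gt0 => j _; exact: r0.
have HXXZ : ent X <= ent (fun t => (X t, Z t)).
  exact: (@ent_comp _ _ fst _ mXZ).
apply: (le_trans HXXZ).
have := @cross_entropy _ _ q mXZ; set s := (X in _ <= - X); move=> h.
apply: (@le_trans _ _ (- s)).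
  apply: h => [[a b]||[a b] ab0] /=.
  - by rewrite mulr_ge0 ?law_ge0// ltW.
  - rewrite -(pair_bigA _ (fun (a : {ffun 'I_k -> 'I_m}) b =>
      law Z b * \prod_j r (a j) (g b j)))/=.
    rewrite exchange_big/= -[leRHS](law_sum1 mZ); apply: ler_sum => b _.
    rewrite -mulr_sumr ler_piMr ?law_ge0//.
    rewrite -(bigA_distr_bigA (fun j i => r i (g b j))).
    by apply: prodr_ile1 => j _; rewrite r1 andbT sumr_ge0// => i _; exact: ltW.
  - by rewrite mulr_gt0// (lt_le_trans ab0).
have -> : s = \sum_b law Z b * ln (law Z b) +
    \sum_(a : {ffun 'I_k -> 'I_m}) \sum_b
    law (fun t => (X t, Z t)) (a, b) * (\sum_j ln (r (a j) (g b j))).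
  have -> : \sum_b law Z b * ln (law Z b) = \sum_a \sum_b
    law (fun t => (X t, Z t)) (a, b) * ln (law Z b).
    rewrite exchange_big/=; apply: eq_bigr => b _.
    by rewrite -mulr_suml -law_snd.
  rewrite !pair_bigA/= -big_split/=; apply: eq_bigr => -[a b] _ /=.
  have := law_ge0 (fun t => (X t, Z t)) (a, b).
  rewrite le_eqVlt => /predU1P[<-|ab0]; first by rewrite !mul0r addr0.
  by rewrite /q/= lnM ?posrE ?pr0 ?(lt_le_trans ab0)// ln_prod// mulrDr.
rewrite opprD lerD2l.
apply: (@le_trans _ _ (\sum_(a : {ffun 'I_k -> 'I_m}) \sum_b \sum_j
    law (fun t => (X t, Z t)) (a, b) *
    (- ln (1 - e) + (a j != g b j)%:R * ln (m%:R / e)))).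
  rewrite -sumrN; apply: ler_sum => a _; rewrite -sumrN; apply: ler_sum => b _.
  rewrite -mulrN -sumrN -mulr_sumr ler_wpM2l ?law_ge0//.
  by apply: ler_sum => j _; exact: lr.
rewrite pair_bigA exchange_big/=.
set c := dl * _ - _.
have -> : k%:R * c = \sum_(j < k) c by rewrite sumr_const card_ord mulr_natl.
apply: ler_sum => j _.
under eq_bigr do rewrite -surjective_pairing mulrDr.
rewrite big_split/= -mulr_suml law_sum1// mul1r addrC lerD2r.
under eq_bigr do rewrite mulrA.
rewrite -mulr_suml ler_wpM2r//.
apply: le_trans (Hdl j).
have -> : [set t | X t j <> g (Z t) j] =
    (fun t => (X t, Z t)) @^-1` [set p : {ffun 'I_k -> 'I_m} * F | p.1 j != g p.2 j].
  by apply/seteqP; split=> t /= /eqP.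
rewrite prob_preimage// [leRHS]big_mkcond/=; apply: ler_sum => p _.
by case: ifP; rewrite ?mulr1 ?mulr0.
Qed.

End discrete_entropy.

(** * Approximation of measurable sets by cells *)

Section cell_approximation.
Context (R : realType) (mu : probability (shift_space * measurableTypeR R)%type R).
Local Notation space := (shift_space * measurableTypeR R)%type.

(** Cells are given by a relation instead of a list of sets: an approximating set only has to be
    saturated for it, and refining the cells is [same_cellW]. *)
Definition same_cell (N : nat) (cs : seq R) (p q : space) : Prop :=
  (forall i, (i < N)%N -> p.1 i = q.1 i) /\
  (forall c, c \in cs -> ((p.2 : R) <= c) = ((q.2 : R) <= c)).

Lemma same_cellW (N M : nat) (cs ds : seq R) (p q : space) : (N <= M)%N ->
  {subset cs <= ds} -> same_cell M ds p q -> same_cell N cs p q.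
Proof.
move=> NM sub [h1 h2]; split=> [i iN|c cc]; first exact/h1/(leq_trans iN).
exact/h2/sub.
Qed.

Lemma same_cell_sym (N : nat) (cs : seq R) (p q : space) :
  same_cell N cs p q -> same_cell N cs q p.
Proof. by move=> [h1 h2]; split=> [i /h1|c /h2] ->. Qed.

Definition symdiff (A B : set space) : set space := (A `\` B) `|` (B `\` A).

Lemma measurable_symdiff (A B : set space) :
  measurable A -> measurable B -> measurable (symdiff A B).
Proof. by move=> mA mB; apply: measurableU; apply: measurableD. Qed.

Definition approximable (A : set space) : Prop := measurable A /\
  forall e, 0 < e -> exists (N : nat) (cs : seq R) (E : set space),
    [/\ measurable E, forall p q, same_cell N cs p q -> E p -> E q
      & prob mu (symdiff A E) <= e].

Lemma approximableC (A : set space) : approximable A -> approximable (~` A).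
Proof.
move=> [mA hA]; split=> [|e /hA[N [cs [E [mE hE AE]]]]]; first exact: measurableC.
exists N, cs, (~` E); split; first exact: measurableC.
  by move=> p q pq Ep Eq; apply: Ep; apply: hE Eq; exact: same_cell_sym.
apply: le_trans AE; rewrite /symdiff !setDE !setCK.
by rewrite setUC [E `&` _]setIC [~` E `&` _]setIC.
Qed.

Lemma approximableU (A B : set space) : approximable A -> approximable B ->
  approximable (A `|` B).
Proof.
move=> [mA hA] [mB hB]; split=> [|e e0]; first exact: measurableU.
have e20 : 0 < e / 2 by rewrite divr_gt0.
have [N [cs [E [mE hE AE]]]] := hA _ e20.
have [M [ds [F [mF hF BF]]]] := hB _ e20.
exists (maxn N M), (cs ++ ds), (E `|` F); split; first exact: measurableU.
  move=> p q pq [Ep|Fp]; [left|right].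
    apply: hE Ep; apply: same_cellW pq; first exact: leq_maxl.
    by move=> c cc; rewrite mem_cat cc.
  apply: hF Fp; apply: same_cellW pq; first exact: leq_maxr.
  by move=> c cc; rewrite mem_cat cc orbT.
rewrite [leRHS](splitr e) (le_trans _ (lerD AE BF))//.
apply: le_trans (prob_setU_le _ _ _); try exact: measurable_symdiff.
apply: le_prob.
- by apply: measurable_symdiff; exact: measurableU.
- by apply: measurableU; exact: measurable_symdiff.
- move=> p [[[Ap|Bp] /not_orP[nE nF]]|[[Ep|Fp] /not_orP[nA nB]]].
  + by left; left.
  + by right; left.
  + by left; right.
  + by right; right.
Qed.

Lemma approximable_cell (N : nat) (cs : seq R) (A : set space) :
  measurable A -> (forall p q, same_cell N cs p q -> A p -> A q) ->
  approximable A.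
Proof.
move=> mA hA; split=> // e e0; exists N, cs, A; split=> //.
by rewrite /symdiff setDv setU0 /prob measure0 ltW.
Qed.

Lemma approximable0 : approximable set0.
Proof. by apply: (@approximable_cell 0 [::]). Qed.

Lemma approximable_bigsetU (A : nat -> set space) (n : nat) :
  (forall i, approximable (A i)) -> approximable (\big[setU/set0]_(i < n) A i).
Proof.
move=> hA; elim/big_ind: _ => [|B C|i _]; [exact: approximable0| |exact: hA].
exact: approximableU.
Qed.

(** Continuity from below leaves a finite union within [e / 2] of the whole, and that finite union
    is approximated within [e / 2]. *)
Lemma approximable_bigcup (A : nat -> set space) :
  (forall i, approximable (A i)) -> approximable (\bigcup_i A i).
Proof.
move=> hA; have mA : measurable (\bigcup_i A i).
  by apply: bigcup_measurable => i _; have [] := hA i.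
pose B n := \big[setU/set0]_(i < n) A i.
have hB n : approximable (B n) by exact: approximable_bigsetU.
have BA n : B n `<=` \bigcup_i A i.
  by rewrite /B -bigcup_mkord => p [i _ Ap]; exists i.
split=> // e e0; have e20 : 0 < e / 2 by rewrite divr_gt0.
have : mu \o B @ \oo --> mu (\bigcup_i A i).
  have -> : \bigcup_i A i = \bigcup_n B n.
    rewrite eqEsubset; split=> p [i _ h]; last exact: BA h.
    by exists i.+1 => //; rewrite /B -bigcup_mkord; exists i => /=.
  apply: nondecreasing_cvg_mu.
  - by move=> n; have [] := hB n.
  - by apply: bigcup_measurable => n _; have [] := hB n.
  - by move=> m n mn; apply/subsetPset; exact: subset_bigsetU.
rewrite -(probE mu mA) => /fine_cvgP[_ /cvgrPdist_le/(_ _ e20)[n _ /(_ n)]].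
rewrite /= => /(_ (leqnn n)).
rewrite -/(prob mu (B n)) => hn.
have [mB /(_ _ e20)[N [cs [E [mE hE BE]]]]] := hB n.
exists N, cs, E; split=> //.
rewrite [leRHS](splitr e).
apply: (@le_trans _ _ (prob mu (\bigcup_i A i `\` B n) + prob mu (symdiff (B n) E))).
  apply: le_trans (prob_setU_le _ _ _); first apply: le_prob.
  - exact: measurable_symdiff.
  - by apply: measurableU; [exact: measurableD|exact: measurable_symdiff].
  - move=> p [[Ap nE]|[Ep nA]].
      have [Bp|nB] := pselect (B n p); first by right; left.
      by left.
    by right; right; split=> // /BA.
  - exact: measurableD.
  - exact: measurable_symdiff.
apply: lerD => //; apply: le_trans hn.
rewrite -lee_fin probE; last exact: measurableD.
rewrite measureD//=; last by rewrite -ge0_fin_numE// fin_num_measure.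
have /setIidPr -> := BA n.
by rewrite -!probE// -EFinB lee_fin ler_norm.
Qed.

(** The sets with approximable preimage form a sigma-algebra, so the generators suffice. *)
Lemma approximable_sigma (T' : Type) (h : space -> T') (G : set (set T')) :
  (forall A, G A -> approximable (h @^-1` A)) ->
  forall A, <<s G >> A -> approximable (h @^-1` A).
Proof.
move=> hG A; pose H : set (set T') := [set A | approximable (h @^-1` A)].
suff : <<s G >> `<=` H by apply.
apply: smallest_sub => //; split.
- by rewrite /H /= preimage_set0; exact: approximable0.
- by move=> B hB; rewrite /H /= setTD preimage_setC; exact: approximableC.
- by move=> B hB; rewrite /H /= preimage_bigcup; exact: approximable_bigcup.
Qed.

Lemma approximable_fst (A : set shift_space) :
  measurable A -> approximable (fst @^-1` A).
Proof.
apply: approximable_sigma => _ [i [b ->]].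
apply: (@approximable_cell i.+1 [::]) => [|p q [h _] /= <-]; last first.
  exact/esym/h.
rewrite -[X in measurable X]setTI; apply: measurable_fst => //.
by apply: sub_sigma_algebra; exists i, b.
Qed.

Lemma approximable_snd (B : set (measurableTypeR R)) :
  measurable B -> approximable (snd @^-1` B).
Proof.
apply: approximable_sigma => C /ocitvP[->|[[a b] _ ->]].
  by rewrite preimage_set0; exact: approximable0.
(* The two cuts [a] and [b] decide membership in []a, b]], without any letter. *)
apply: (@approximable_cell 0 [:: a; b]) => [|p q [_ h] /=].
  rewrite -[X in measurable X]setTI.
  exact: (@measurable_snd _ _ shift_space (measurableTypeR R) measurableT _
    (measurable_itv `]a, b])).
have := h a; have := h b; rewrite !inE !eqxx orbT => /(_ isT) hb /(_ isT) ha.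
by rewrite !subitvE !bnd_simp !ltNge ha hb.
Qed.

Lemma measurable_approximable (A : set space) : measurable A -> approximable A.
Proof.
rewrite measurable_prod_measurableType => mA.
rewrite -[A]preimage_id; move: A mA; apply: approximable_sigma => _ [A mA [B mB <-]].
have -> : A `*` B = ~` (~` (fst @^-1` A) `|` ~` (snd @^-1` B)).
  by rewrite setCU !setCK.
apply: approximableC; apply: approximableU; apply: approximableC.
  exact: approximable_fst.
exact: approximable_snd.
Qed.

End cell_approximation.

(** * Entropy of the lift *)

Section lift_map.
Context (R : realType) (phi : bool -> R -> R).
Local Notation space := (shift_space * measurableTypeR R)%type.
Local Notation f := (lift_map phi).

Definition letters (k : nat) (p : space) : {ffun 'I_k -> bool} :=
  [ffun i : 'I_k => p.1 i].

Lemma iter_lift1 (j : nat) (p : space) (i : nat) : (iter j f p).1 i = p.1 (i + j)%N.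
Proof.
elim: j p i => [|j IH] p i; first by rewrite addn0.
by rewrite iterS; transitivity ((iter j f p).1 i.+1); rewrite // IH addSnnS.
Qed.

Lemma iter_lift2S (j : nat) (p : space) :
  (iter j.+1 f p).2 = phi (p.1 j) (iter j f p).2.
Proof. by rewrite iterS; congr phi; exact: iter_lift1. Qed.

Lemma measurable_letter (i : nat) : measurable [set p : space | p.1 i].
Proof.
rewrite -[X in measurable X]setTI.
apply: (@measurable_fst _ _ shift_space (measurableTypeR R) measurableT
  [set w : shift_space | w i = true]).
by apply: sub_sigma_algebra; exists i, true.
Qed.

Lemma discrete_letter (i : nat) : discrete_rv (fun p : space => p.1 i).
Proof. by apply: discrete_rv_bool; exact: measurable_letter. Qed.

Lemma discrete_letters (k : nat) : discrete_rv (letters k).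
Proof.
exact: (@discrete_rv_ffun _ space 'I_k _ (fun (i : 'I_k) (p : space) => p.1 i)
  (fun i => discrete_letter i)).
Qed.

Hypothesis mphi : forall i, measurable_fun [set: measurableTypeR R]
  (phi i : measurableTypeR R -> measurableTypeR R).

Lemma measurable_shift : measurable_fun [set: shift_space] Defs.shift.
Proof.
apply: (@measurability _ _ shift_space shift_space _ _ coordinate_sets) => //.
move=> _ [_ [i [b ->]] <-]; rewrite setTI.
by apply: sub_sigma_algebra; exists i.+1, b.
Qed.

Lemma measurable_lift : measurable_fun [set: space] f.
Proof.
apply/measurable_fun_pairP; split.
  apply: (measurableT_comp measurable_shift); exact: measurable_fst.
have -> : snd \o f = fun p : space => if p.1 0%N then phi true p.2 else phi false p.2.
  by apply/funext => -[w x] /=; case: (w 0%N).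
apply: measurable_fun_ifT.
- apply: (measurable_fun_bool true).
  by rewrite setTI; exact: measurable_letter.
- by apply: (measurableT_comp (mphi true)); exact: measurable_snd.
- by apply: (measurableT_comp (mphi false)); exact: measurable_snd.
Qed.

Lemma measurable_iter_lift (j : nat) : measurable_fun [set: space] (iter j f).
Proof.
elim: j => [|j IH]; first exact: measurable_id.
exact: (measurableT_comp measurable_lift IH).
Qed.

End lift_map.

(** * Entropy of partitions compared with entropy of words *)

Section entropy_of_lift.
Context (R : realType) (phi : bool -> R -> R).
Local Notation space := (shift_space * measurableTypeR R)%type.
Local Notation f := (lift_map phi).
Context (mu : probability space R).
Hypothesis mphi : forall i, measurable_fun [set: measurableTypeR R]
  (phi i : measurableTypeR R -> measurableTypeR R).
Hypothesis homo_phi : forall i, {homo phi i : x y / x <= y}.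
Hypothesis inv : forall A, measurable A -> pushforward mu f A = mu A.

Lemma iter_lift2_homo (j : nat) (p q : space) :
  (forall i, (i < j)%N -> p.1 i = q.1 i) -> (p.2 : R) <= q.2 ->
  ((iter j f p).2 : R) <= (iter j f q).2.
Proof.
elim: j => [//|j IH] pq p2q2; rewrite !iter_lift2S pq//.
by apply: homo_phi; apply: IH => // i ij; apply: pq; exact: ltnW.
Qed.

Lemma measurable_preimage_iter (j : nat) (A : set space) : measurable A ->
  measurable (iter j f @^-1` A).
Proof.
by move=> mA; rewrite -[X in measurable X]setTI;
  exact: (measurable_iter_lift mphi j measurableT mA).
Qed.

Lemma measure_iter_lift (j : nat) (A : set space) : measurable A ->
  mu (iter j f @^-1` A) = mu A.
Proof.
move=> mA; elim: j => [//|j IH].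
rewrite -[RHS]IH -[RHS]inv; last first.
  exact: measurable_preimage_iter.
by congr (mu _); apply/funext => p; rewrite /preimage /mkset iterSr.
Qed.

Lemma discrete_rv_iter (F : finType) (X : space -> F) (j : nat) :
  discrete_rv X -> discrete_rv (X \o iter j f).
Proof.
by move=> mX a; rewrite comp_preimage; exact: (measurable_preimage_iter j (mX a)).
Qed.

Lemma prob_iter_lift (j : nat) (A : set space) : measurable A ->
  prob mu (iter j f @^-1` A) = prob mu A.
Proof. by move=> mA; rewrite /prob measure_iter_lift. Qed.

Lemma ent_iter_lift (F : finType) (X : space -> F) (j : nat) : discrete_rv X ->
  ent mu (X \o iter j f) = ent mu X.
Proof.
move=> mX; congr (- _); apply: eq_bigr => a _.
suff -> : law mu (X \o iter j f) a = law mu X a by [].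
exact: prob_iter_lift.
Qed.

Let E (k : nat) : R := ent mu (letters k).

Lemma ent_letters_le (k : nat) : E k <= k%:R * ln 2.
Proof.
rewrite /E (le_trans (ent_le_ln_card mu (@discrete_letters R k)))//.
rewrite card_ffun card_bool card_ord natrX lnXn ?ltr0n//.
by rewrite mulr_natl.
Qed.

(** The letters from [a] to [a + b - 1] are the first [b] letters after [a] iterations, so by
    invariance they have entropy [E b]; subadditivity of entropy concludes. *)
Lemma ent_lettersD (a b : nat) : E (a + b) <= E a + E b.
Proof.
rewrite /E -[X in _ <= _ + X](ent_iter_lift a (@discrete_letters R b)).
have mb := discrete_rv_iter a (@discrete_letters R b).
have ma := @discrete_letters R a.
apply: (le_trans _ (ent_pair mu ma mb)).
pose g (z : {ffun 'I_a -> bool} * {ffun 'I_b -> bool}) : {ffun 'I_(a + b) -> bool} :=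
  [ffun i : 'I_(a + b) => match fintype.split i with inl i' => z.1 i' | inr i' => z.2 i' end].
have -> : letters (a + b) = g \o
    (fun p => (letters a p, (letters b \o iter a f) p)).
  apply/funext => p; apply/ffunP => i; rewrite /g/= !ffunE.
  case: fintype.splitP => j ij; rewrite ffunE ?iter_lift1 ij//.
  by rewrite addnC.
apply: ent_comp; exact: discrete_rv_pair.
Qed.

Lemma ent_lettersM (q l s : nat) : E (q * l + s) <= q%:R * E l + s%:R * ln 2.
Proof.
elim: q => [|q IH]; first by rewrite mul0r add0r; exact: ent_letters_le.
rewrite mulSn -addnA (le_trans (ent_lettersD _ _))//.
by rewrite -nat1r mulrDl mul1r -addrA lerD2l.
Qed.

Definition threshold (k : nat) (cs : seq R) (p : space) :
    {ffun 'I_k * 'I_(size cs) -> bool} :=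
  [ffun ji : 'I_k * 'I_(size cs) => ((iter ji.1 f p).2 : R) <= nth 0 cs ji.2].

Lemma discrete_threshold (k : nat) (cs : seq R) : discrete_rv (threshold k cs).
Proof.
apply: (@discrete_rv_ffun _ space ('I_k * 'I_(size cs))%type bool
  (fun ji p => ((iter ji.1 f p).2 : R) <= nth 0 cs ji.2)) => -[j i] /=.
apply: discrete_rv_bool.
have mI := measurable_itv `]-oo, nth 0 cs i].
have := @measurable_iter_lift R phi mphi j measurableT _
  (@measurable_snd _ _ shift_space (measurableTypeR R) measurableT _ mI).
by rewrite !setTI; congr measurable; apply/seteqP; split=> p /=; rewrite in_itv.
Qed.

(* The number of cuts lying above the orbit of a point; together with the letters
it recovers the positions of the orbit relative to all the cuts, because along a
fixed word the maps are monotone in the real coordinate. *)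
Definition rank (k : nat) (cs : seq R) (p : space) : 'I_(k * size cs).+1 :=
  inord #|[pred ji | threshold k cs p ji]|.

Lemma rankE (k : nat) (cs : seq R) (p : space) :
  rank k cs p = #|[pred ji | threshold k cs p ji]| :> nat.
Proof.
by rewrite inordK// ltnS (leq_trans (max_card _))// card_prod !card_ord.
Qed.

Lemma discrete_rank (k : nat) (cs : seq R) : discrete_rv (rank k cs).
Proof.
pose g (z : {ffun 'I_k * 'I_(size cs) -> bool}) : 'I_(k * size cs).+1 :=
  inord #|[pred ji | z ji]|.
have -> : rank k cs = g \o threshold k cs by [].
apply: discrete_rv_comp; exact: discrete_threshold.
Qed.

(** Along a common word the orbits stay ordered, so the set of cuts above the higher orbit is
    contained in the set for the lower one; equal cardinalities make the two sets equal. *)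
Lemma rank_threshold (k : nat) (cs : seq R) (p q : space) :
  (forall i, (i < k)%N -> p.1 i = q.1 i) -> rank k cs p = rank k cs q ->
  threshold k cs p = threshold k cs q.
Proof.
wlog le_pq : p q / (p.2 : R) <= q.2.
  move=> wl pq rpq; have [le_pq|/ltW le_qp] := leP (p.2 : R) q.2; first exact: wl.
  by symmetry; apply: wl => // i /pq.
move=> pq /(congr1 val) /=; rewrite !rankE => card_pq.
have sub : [pred ji | threshold k cs q ji] \subset [pred ji | threshold k cs p ji].
  apply/fintype.subsetP => -[j i]; rewrite !finset.inE !ffunE /=.
  apply: le_trans; apply: iter_lift2_homo => // i' i'j.
  exact/pq/(ltn_trans i'j).
have := subset_leqif_card sub; rewrite card_pq => -[_ /esym].
rewrite eqxx => /fintype.subsetP bus; apply/ffunP => ji.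
by apply/idP/idP; [exact: bus|exact: (fintype.subsetP sub)].
Qed.

(** The [N] extra letters let the code determine the first [N] letters of every iterate of index
    below [k]. *)
Definition code (N k : nat) (cs : seq R) (p : space) :=
  (letters (k + N) p, rank k cs p).

Lemma discrete_code (N k : nat) (cs : seq R) : discrete_rv (code N k cs).
Proof.
by apply: discrete_rv_pair; [exact: discrete_letters|exact: discrete_rank].
Qed.

Lemma code_same_cell (N k : nat) (cs : seq R) (p q : space) :
  code N k cs p = code N k cs q -> forall j, (j < k)%N ->
  same_cell N cs (iter j f p) (iter j f q).
Proof.
move=> [/ffunP hl hr] j jk.
have pq i : (i < k + N)%N -> p.1 i = q.1 i.
  by move=> ik; have := hl (Ordinal ik); rewrite !ffunE.
have /ffunP ht : threshold k cs p = threshold k cs q.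
  by apply: rank_threshold => // i ik; apply: pq; rewrite ltn_addr.
split=> [i iN|c /(nthP 0)[i ics <-]].
  by rewrite !iter_lift1 pq// addnC -addSn leq_add// ltnW.
by have := ht (Ordinal jk, Ordinal ics); rewrite !ffunE.
Qed.

(** The rank takes only [k * size cs + 1] values, so the real coordinate adds no more than a
    logarithm in [k]. *)
Lemma ent_code_le (N k : nat) (cs : seq R) :
  ent mu (code N k cs) <= E (k + N) + ln (k * size cs).+1%:R.
Proof.
have mr : discrete_rv (rank k cs) by exact: discrete_rank.
apply: (le_trans (ent_pair _ (@discrete_letters R _) mr)).
by rewrite lerD2l (le_trans (ent_le_ln_card _ _))// card_ord.
Qed.

(** The partition is replaced by a function of the cells that disagrees with it with probability at
    most [dl]. By invariance the same error holds at each time, and [ent_fano] compares the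
    itinerary with the code of the orbit. That [N] and [r] do not depend on [k] is what makes the
    bound useful as [k] grows. *)
Lemma join_entropy_le (m : nat) (P : space -> 'I_m) (e dl : R) :
  0 < e < 1 -> 0 < dl -> finite_partition P ->
  exists N r : nat, forall k, join_entropy f mu P k <=
    E (k + N) + ln (k * r).+1%:R + k%:R * (dl * ln (m%:R / e) - ln (1 - e)).
Proof.
move=> he dl0 mP.
pose p0 : space := (fun=> false, 0).
have m0 : (0 < m)%N by exact: leq_trans (ltn_ord (P p0)).
(* An error of [dl / m] for each of the [m] cells adds up to [dl]. *)
have e'0 : 0 < dl / m%:R by rewrite divr_gt0// ltr0n.
have /choice[N /choice[cs /choice[A hA]]] := fun i : 'I_m =>
  (measurable_approximable mu (mP i)).2 _ e'0.
pose NN := (\max_i N i)%N.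
pose cc := flatten [seq cs i | i <- enum 'I_m].
have AP i p q : same_cell NN cc p q -> A i p -> A i q.
  have [_ h _] := hA i; move=> pq; apply: h; apply: same_cellW pq.
    exact: leq_bigmax.
  move=> c ci; apply/flattenP; exists (cs i) => //.
  by apply: map_f; rewrite mem_enum.
pose I p := [ffun i => `[< A i p >]].
(* The approximating sets need neither be disjoint nor cover the space: [D] picks one that contains
   the point, with [P p0] as default. *)
pose D (z : {ffun 'I_m -> bool}) := odflt (P p0) [pick i | z i].
have mI : discrete_rv I.
  apply: (@discrete_rv_ffun _ space 'I_m bool (fun i p => `[< A i p >])) => i.
  apply: discrete_rv_bool; have [mA _ _] := hA i.
  by have -> : [set p | `[< A i p >]] = A i by apply/seteqP; split=> p /= /asboolP.
have Icell p q : same_cell NN cc p q -> I p = I q.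
  move=> pq; apply/ffunP => i; rewrite !ffunE; apply/asboolP/asboolP; apply: AP => //.
  exact: same_cell_sym.
have mDI : discrete_rv (D \o I) by exact: discrete_rv_comp.
have mPD := discrete_rv_pair (X := P) mP mDI.
have mB : measurable [set p | P p <> D (I p)].
  have -> : [set p | P p <> D (I p)] =
      (fun p => (P p, D (I p))) @^-1` [set z | z.1 <> z.2] by [].
  exact: discrete_rv_preimage.
(* At a point of disagreement, either the set approximating the true cell misses the point, or [D]
   has picked a set containing the point although its cell does not. Both put the point in a
   symmetric difference. *)
have PD : prob mu [set p | P p <> D (I p)] <= dl.
  apply: (@le_trans _ _ (\sum_(i < m) prob mu (symdiff (P @^-1` [set i]) (A i)))).
    have mS i : measurable (symdiff (P @^-1` [set i]) (A i)).
      by have [mA _ _] := hA i; exact: measurable_symdiff.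
    apply: le_trans (prob_bigsetU_le mu mS); apply: le_prob => //.
      by apply: bigsetU_measurable => i _; exact: mS.
    move=> p /= Pp; rewrite -bigcup_seq.
    have mem i : [set` index_enum 'I_m] i by rewrite /= mem_index_enum.
    have [Ap|nAp] := pselect (A (P p) p); last by exists (P p) => //; left; split.
    move: Pp; rewrite /D; case: pickP => /= [i|/(_ (P p))]; rewrite ffunE.
      by move=> /asboolP Ai Pp; exists i => //; right; split=> // /= /Pp.
    by move/asboolP.
  apply: (@le_trans _ _ (\sum_(i < m) (dl / m%:R))).
    by apply: ler_sum => i _; have [] := hA i.
  by rewrite sumr_const card_ord -[_ / _ *+ _]mulr_natr divfK// pnatr_eq0 -lt0n.
exists NN, (size cc) => k.
pose X p := [ffun j : 'I_k => P (iter j f p)].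
have mX : discrete_rv X.
  apply: (@discrete_rv_ffun _ space 'I_k _ (fun j p => P (iter j f p))) => j.
  exact: (discrete_rv_iter j mP).
pose tup (z : {ffun 'I_k -> 'I_m}) : k.-tuple 'I_m := [tuple z j | j < k].
have -> : join_entropy f mu P k = ent mu (tup \o X).
  congr (- _); apply: eq_bigr => a _.
  suff -> : join_cell f P a = (tup \o X) @^-1` [set a] by [].
  apply/seteqP; split=> p /=.
    by move=> h; apply: eq_from_tnth => j; rewrite tnth_mktuple ffunE.
  by move=> <- j; rewrite tnth_mktuple ffunE.
apply: (le_trans (ent_comp _ _ mX)).
(* Decoding uses an arbitrary point with the given code; by [code_same_cell] and [Icell] the result
   does not depend on the choice. Codes that never occur get a constant default. *)
pose g z : {ffun 'I_k -> 'I_m} :=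
  if pselect (exists p, code NN k cc p = z) is left h
  then [ffun j : 'I_k => D (I (iter j f (projT1 (cid h))))]
  else [ffun=> P p0].
have gE p : g (code NN k cc p) = [ffun j : 'I_k => D (I (iter j f p))].
  rewrite /g; case: pselect => [h|]; last by case; exists p.
  case: cid => q /= cq; apply/ffunP => j; rewrite !ffunE; congr D.
  by apply: Icell; apply: code_same_cell cq _ _.
apply: (le_trans (@ent_fano _ _ _ _ _ _ _ _ _ g e dl m0 he mX (@discrete_code NN k cc) _)).
  move=> j; apply: le_trans PD.
  rewrite -(prob_iter_lift j mB) le_eqVlt; apply/orP; left; apply/eqP.
  by congr prob; apply/seteqP; split=> p /=; rewrite gE !ffunE.
by rewrite lerD2r ent_code_le.
Qed.

End entropy_of_lift.

(** * Uniformity of the letters under maximal entropy *)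

Section maximal_entropy.
Context (R : realType) (phi : bool -> R -> R).
Local Notation space := (shift_space * measurableTypeR R)%type.
Local Notation f := (lift_map phi).
Context (mu : probability space R).
Hypothesis mphi : forall i, measurable_fun [set: measurableTypeR R]
  (phi i : measurableTypeR R -> measurableTypeR R).
Hypothesis homo_phi : forall i, {homo phi i : x y / x <= y}.
Hypothesis inv : forall A, measurable A -> pushforward mu f A = mu A.

(** Exponentiated, this follows from [1 + x ^+ 2 / 2 <= expR x] at [x = t * k], once [t ^+ 2 * k]
    exceeds [2 * r]. *)
Lemma ln_linear_le (r : nat) (t : R) : 0 < t ->
  \forall k \near \oo, ln (k * r).+1%:R <= t * k%:R.
Proof.
move=> t0; near=> k.
rewrite -ler_expR lnK ?posrE//.
have tk0 : 0 <= t * k%:R by rewrite mulr_ge0// ltW.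
apply: le_trans (expR_ge1Dxn 1 tk0).
rewrite -nat1r lerD2l natrM (_ : 2`! = 2)%N//.
have -> : (t * k%:R) ^+ 2 = k%:R * (t ^+ 2 * k%:R) by ring.
rewrite ler_pdivlMr// -mulrA ler_wpM2l// mulrC -ler_pdivrMl ?exprn_gt0// mulrC.
by near: k; exact: nbhs_infty_ger.
Unshelve. all: by end_near. Qed.

(** A deficit [d] in the entropy of blocks of length [l] would, by subadditivity, recur in each of
    about [k / l] blocks. The entropy of every partition would then stay away from [ln 2], since the
    other terms of [join_entropy_le] can be made small relative to [k]. *)
Lemma ent_letters_max (l : nat) : ((ln 2)%:E <= measure_entropy f mu)%E ->
  l%:R * ln 2 <= ent mu (letters l).
Proof.
move=> hmu; rewrite leNgt; apply/negP => El.
have El0 : 0 <= ent mu (letters l) by apply: ent_ge0; exact: discrete_letters.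
have l0 : (0 < l)%N.
  case: (posnP l) => // l0; move: El.
  by rewrite (_ : l%:R = 0) ?l0// mul0r ltNge -l0 El0.
have l0R : 0 < l%:R :> R by rewrite ltr0n.
pose d := l%:R * ln 2 - ent mu (letters l).
have d0 : 0 < d by rewrite subr_gt0.
have ln20 : 0 < ln 2 :> R by rewrite ln_gt0// ltr1n.
(* The deficit rate [d / l] is [4 * t]: one [t] each is spent on the distance of a partition entropy
   from [ln 2], on the rank, on the Fano cost and on the boundary terms [N * ln 2 + d]. *)
pose t := d / (4 * l%:R).
have t0 : 0 < t by rewrite divr_gt0// mulr_gt0.
have dt : d = 4 * t * l%:R by rewrite /t; field; rewrite gt_eqF.
have t_ln2 : t < ln 2.
  rewrite /t ltr_pdivrMr ?mulr_gt0// /d.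
  rewrite (le_lt_trans (y := l%:R * ln 2)) ?gerBl//.
  by have := mulr_gt0 l0R ln20; lra.
have /ereal_sup_gt[_ [m [P [mP ->]]]] : ((ln 2 - t)%:E < measure_entropy f mu)%E.
  by apply: lt_le_trans hmu; rewrite lte_fin ltrBlDr ltrDl.
rewrite lte_fin /partition_entropy; set u := (fun k : nat => _) => Lt.
(* A divergent sequence has the default limit 0, which the positive lower bound [ln 2 - t]
   excludes. *)
have cu : cvgn u.
  apply: contrapT => /dvgP u0; move: Lt; rewrite u0.
  by rewrite ltNge subr_ge0 (ltW t_ln2).
(* With this choice [- ln (1 - e)] is exactly [t / 2]. *)
pose e : R := 1 - expR (- (t / 2)).
have t20 : 0 < t / 2 by rewrite divr_gt0.
have he : 0 < e < 1.
  rewrite /e subr_gt0 expR_lt1 oppr_lt0 t20/= ltrBlDr ltrDl; exact: expR_gt0.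
have m0 : (0 < m)%N := leq_trans _ (ltn_ord (P (fun=> false, 0))).
have lnme : 0 <= ln (m%:R / e).
  move/andP: he => [e0 e1].
  by rewrite ln_ge0// ler_pdivlMr// mul1r (le_trans (ltW e1))// ler1n m0.
(* The summand 1 keeps the denominator positive; the product with [ln (m / e)] is at most
   [t / 2]. *)
pose dl := t / 2 / (ln (m%:R / e) + 1).
have dl0 : 0 < dl by rewrite divr_gt0// ltr_wpDl.
have cost : dl * ln (m%:R / e) - ln (1 - e) <= t.
  rewrite /e opprB addrCA subrr addr0 expRK opprK [leRHS](splitr t) lerD2r.
  rewrite /dl -mulrA ler_piMr ?(ltW t20)// mulrC ler_pdivrMr ?ltr_wpDl//.
  by rewrite mul1r lerDl.
have [N [r Hk]] := join_entropy_le mphi homo_phi inv he dl0 mP.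
have : \forall k \near \oo, False.
  near=> k.
  have k0 : (0 < k)%N by near: k; exact: nbhs_infty_gt.
  have k0R : 0 < k%:R :> R by rewrite ltr0n.
  have uk : ln 2 - t < u k by near: k; exact: (cvgr_gt _ cu).
  have lnk : ln (k * r).+1%:R <= t * k%:R by near: k; exact: ln_linear_le.
  have kN : N%:R * ln 2 + d <= t * k%:R.
    rewrite [leRHS]mulrC -ler_pdivrMr//; near: k; exact: nbhs_infty_ger.
  (* The quotient [q] satisfies [k <= (q + 1) * l], so the accumulated deficit [q * d] is at least
     [4 * t * k - d]. *)
  have hE : ent mu (letters (k + N)) <=
      (k + N)%:R * ln 2 - (4 * t * k%:R - d).
    set q := ((k + N) %/ l)%N.
    rewrite [X in ent mu (letters X)](divn_eq (k + N) l) -/q.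
    apply: (le_trans (ent_lettersM mphi inv _ _ _)).
    have -> : (k + N)%:R = q%:R * l%:R + ((k + N) %% l)%:R :> R.
      by rewrite -natrM -natrD -divn_eq.
    have -> : ent mu (letters l) = l%:R * ln 2 - d by rewrite /d; lra.
    have : k%:R <= (q%:R + 1) * l%:R :> R.
      rewrite natr1 -natrM ler_nat mulSn addnC (leq_trans (leq_addr N k))//.
      by rewrite [leqLHS](divn_eq _ l) leq_add2l ltnW// ltn_mod.
    move=> kq; have : 4 * t * k%:R <= 4 * t * ((q%:R + 1) * l%:R).
      by rewrite ler_pM2l// mulr_gt0.
    have -> : 4 * t * ((q%:R + 1) * l%:R) = (q%:R + 1) * d by rewrite dt; ring.
    move=> {}kq.
    by rewrite mulrBr mulrDl mulrA; lra.
  move: uk; rewrite /u mulrC ltr_pdivlMr// => uk.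
  have := Hk k.
  have : k%:R * (dl * ln (m%:R / e) - ln (1 - e)) <= k%:R * t by rewrite ler_wpM2l.
  move: hE; rewrite natrD; lra.
by move=> [k _ /(_ k (leqnn k))].
Unshelve. all: by end_near. Qed.

(** The entropy of the [2 ^ l] words attains its maximum [l * ln 2], which only the uniform law
    does. *)
Lemma law_letters (l : nat) (a : {ffun 'I_l -> bool}) :
  ((ln 2)%:E <= measure_entropy f mu)%E -> law mu (letters l) a = 2^-1 ^+ l.
Proof.
move=> hmu; rewrite (ent_uniform a (@discrete_letters R l)).
  by rewrite card_ffun card_bool card_ord natrX exprVn.
apply/eqP; rewrite eq_le ent_le_ln_card/=; last exact: discrete_letters.
by rewrite card_ffun card_bool card_ord natrX lnXn// -[ln 2 *+ _]mulr_natl ent_letters_max.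
Qed.

End maximal_entropy.

(** * The Bernoulli measure *)

(* The canonical instance takes the proof of measurability as an argument, which
unification cannot recover from the function alone. *)
Local Notation pushforward_measure :=
  measure_function_pushforward__canonical__measure_function_Measure.

Section bernoulli_measure.
Context (R : realType).

Definition doubling (u : R) : R := if u < 2^-1 then 2 * u else 2 * u - 1.

(** Binary expansion on [[0, 1[], used to obtain the Bernoulli measure as an image of Lebesgue
    measure. *)
Definition digits (u : measurableTypeR R) : shift_space :=
  fun i => 2^-1 <= iter i doubling u.

(** The left endpoint of the dyadic interval of points whose binary expansion starts with [s]. *)
Fixpoint dyadic (s : seq bool) : R :=
  if s is b :: s' then (b%:R + dyadic s') / 2 else 0.

Lemma dyadic_bounds (s : seq bool) : 0 <= dyadic s /\ dyadic s + 2^-1 ^+ size s <= 1.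
Proof.
elim: s => [|b s [IH0 IH1]] /=; first by rewrite add0r expr0.
by rewrite exprS; case: b => /=; split; lra.
Qed.

Lemma mkseq_shift (w : shift_space) (k : nat) :
  mkseq w k.+1 = w 0%N :: mkseq (Defs.shift w) k.
Proof. by rewrite /mkseq /= (iotaDl 1 0 k) -map_comp. Qed.

Lemma digits_doubling (u : R) : digits (doubling u) = Defs.shift (digits u).
Proof. by apply/funext => i; rewrite /digits /Defs.shift iterSr. Qed.

Lemma mkseq_digits (s : seq bool) (u : R) : 0 <= u < 1 ->
  (mkseq (digits u) (size s) == s) = (dyadic s <= u < dyadic s + 2^-1 ^+ size s).
Proof.
elim: s u => [|b s IH] u /andP[u0 u1] /=.
  by rewrite add0r expr0 u0 u1 eqxx.
have [low0 low1] := dyadic_bounds s.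
rewrite mkseq_shift eqseq_cons -digits_doubling IH; last first.
  by rewrite /doubling; case: ltP => h; apply/andP; split; lra.
rewrite {1}/digits /doubling /= exprS.
have [h|h] := ltP u 2^-1; case: b => /=.
- by apply/esym/negbTE; rewrite negb_and -!ltNge; apply/orP; left; lra.
- by apply/idP/idP => /andP[? ?]; apply/andP; split; lra.
- by apply/idP/idP => /andP[? ?]; apply/andP; split; lra.
- by apply/esym/negbTE; rewrite negb_and -!leNgt; apply/orP; right; lra.
Qed.

Lemma measurable_doubling : measurable_fun [set: measurableTypeR R]
  (doubling : measurableTypeR R -> measurableTypeR R).
Proof.
apply: measurable_fun_ifT.
- by apply: measurable_fun_ltr => //; exact: measurable_cst.
- by apply: measurable_funM => //; exact: measurable_cst.
- apply: measurable_funB; last exact: measurable_cst.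
  by apply: measurable_funM => //; exact: measurable_cst.
Qed.

Lemma measurable_digits : measurable_fun [set: measurableTypeR R] digits.
Proof.
apply: (@measurability _ _ (measurableTypeR R) shift_space _ _ coordinate_sets) => //.
move=> _ [_ [i [b ->]] <-]; rewrite setTI.
have mi : measurable_fun [set: measurableTypeR R]
    (iter i doubling : measurableTypeR R -> measurableTypeR R).
  elim: i => [|i IH]; first exact: measurable_id.
  exact: (measurableT_comp measurable_doubling IH).
have : measurable_fun [set: measurableTypeR R]
    (fun u : measurableTypeR R => (2^-1 : R) <= iter i doubling u).
  by apply: measurable_fun_ler => //; exact: measurable_cst.
by move=> /(_ measurableT [set b] I); rewrite setTI.
Qed.

Definition unit_restriction : set (measurableTypeR R) -> \bar R :=
  mrestr (@lebesgue_measure R) (measurable_itv `[0%R, 1%R[).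

HB.instance Definition _ := Measure.on unit_restriction.

Lemma unit_restrictionT : unit_restriction [set: measurableTypeR R] = 1%E.
Proof. by rewrite /unit_restriction /mrestr setTI lebesgue_measure_itv/= lte01 sube0. Qed.

HB.instance Definition _ := Measure_isProbability.Build _ _ _
  unit_restriction unit_restrictionT.

Definition bernoulli_measure : probability shift_space R :=
  distribution unit_restriction (mfun_Sub (mem_set measurable_digits)).

Definition cylinder (s : seq bool) : set shift_space :=
  [set w | mkseq w (size s) = s].

Lemma bernoulli_cylinder (s : seq bool) :
  bernoulli_measure (cylinder s) = (2^-1 ^+ size s)%:E.
Proof.
rewrite /bernoulli_measure /distribution /pushforward /=.
rewrite /unit_restriction /mrestr.
rewrite [X in lebesgue_measure X](_ : _ =
  `[dyadic s, dyadic s + 2^-1 ^+ size s[%classic).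
  rewrite lebesgue_measure_itv/= lte_fin ltrDl exprn_gt0 ?invr_gt0//.
  by rewrite -EFinD addrAC subrr add0r.
have [low0 low1] := dyadic_bounds s.
apply/seteqP; split=> u /=.
  rewrite in_itv/= => -[us u01]; rewrite in_itv/= -mkseq_digits//.
  exact/eqP.
rewrite in_itv/= => us.
have u01 : 0 <= u < 1 by move/andP: us => [? ?]; apply/andP; split; lra.
split; last by rewrite in_itv.
by apply/eqP; rewrite mkseq_digits.
Qed.
Lemma cylinder_cons (b : bool) (s : seq bool) :
  cylinder (b :: s) = [set w : shift_space | w 0%N = b] `&` Defs.shift @^-1` cylinder s.
Proof.
apply/seteqP; split=> w; rewrite /cylinder /= mkseq_shift.
  by move=> [-> <-]; rewrite size_mkseq.
by move=> [-> ->].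
Qed.

(** The empty set is included so that the family is closed under intersection: two cylinders are
    nested or disjoint. *)
Definition cylinders : set (set shift_space) :=
  [set A | A = set0 \/ exists s, A = cylinder s].

Lemma setI_closed_cylinders : setI_closed cylinders.
Proof.
have take_mkseq (w : shift_space) k l : (k <= l)%N -> take k (mkseq w l) = mkseq w k.
  by move=> kl; rewrite /mkseq -map_take take_iota (minn_idPl kl).
have cylI s t : (size s <= size t)%N -> cylinders (cylinder s `&` cylinder t).
  move=> st; have [ts|ts] := eqVneq (take (size s) t) s.
    right; exists t; apply/seteqP; split=> [w []//|w wt]; split=> //.
    by rewrite /cylinder/= -(take_mkseq w _ _ st) [mkseq _ _]wt.
  left; rewrite -subset0 => w [ws wt]; move/eqP: ts; apply.
  by rewrite -[in LHS]wt take_mkseq.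
move=> A B [->|[s ->]] [->|[t ->]]; rewrite ?set0I ?setI0; try by left.
have [st|/ltnW ts] := leqP (size s) (size t); first exact: cylI.
by rewrite setIC; exact: cylI.
Qed.

Lemma measurable_coordinate (i : nat) (b : bool) :
  measurable [set w : shift_space | w i = b].
Proof. by apply: sub_sigma_algebra; exists i, b. Qed.

Lemma measurable_cylinder (s : seq bool) : measurable (cylinder s).
Proof.
elim: s => [|b s IH].
  by rewrite (_ : cylinder [::] = setT)//; apply/seteqP; split.
rewrite cylinder_cons; apply: measurableI; first exact: measurable_coordinate.
by rewrite -[X in measurable X]setTI; exact: (measurable_shift measurableT IH).
Qed.

Lemma measurable_cylinders :
  (measurable : set (set shift_space)) = <<s cylinders >>.
Proof.
apply/seteqP; split; last first.
  apply: smallest_sub; first exact: sigma_algebra_measurable.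
  by move=> _ [->|[s ->]]; [exact: measurable0|exact: measurable_cylinder].
apply: smallest_sub => // _ [i [b ->]].
have -> : [set w : nat -> bool | w i = b] =
    \bigcup_(t in [set t : i.+1.-tuple bool | nth false t i = b]) cylinder t.
  apply/seteqP; split=> [w wi|w [t /= <-]].
    exists (Tuple (introT eqP (size_mkseq w i.+1))); first by rewrite /= nth_mkseq.
    by change (mkseq w (size (mkseq w i.+1)) = mkseq w i.+1); rewrite size_mkseq.
  by rewrite /cylinder /= size_tuple => <-; rewrite nth_mkseq.
apply: (@fin_bigcup_measurable _ (g_sigma_algebraType cylinders)).
  exact: finite_finset.
by move=> t _; apply: sub_sigma_algebra; right; exists t.
Qed.

(** Independence of the first letter from the others. Both sides are finite measures in [A] that
    agree on cylinders, an intersection-closed family of generators. *)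
Lemma bernoulli_shift (b : bool) (A : set shift_space) : measurable A ->
  bernoulli_measure ([set w : shift_space | w 0%N = b] `&` Defs.shift @^-1` A) =
  ((2^-1)%:E * bernoulli_measure A)%E.
Proof.
have half0 : 0 <= 2^-1 :> R by rewrite invr_ge0.
pose m1 := pushforward_measure
  (mrestr bernoulli_measure (measurable_coordinate 0 b)) measurable_shift.
pose m2 := mscale (NngNum half0) bernoulli_measure.
move=> mA; have : m1 A = m2 A; last first.
  by move=> m12; rewrite setIC; exact: m12.
apply: (measure_unique cylinders (fun=> setT)) => //.
- exact: measurable_cylinders.
- exact: setI_closed_cylinders.
- by move=> _; right; exists [::]; apply/seteqP; split.
- exact: bigcup_const.
- move=> _ [->|[s ->]]; first by rewrite !measure0.
  transitivity ((2^-1)%:E * bernoulli_measure (cylinder s))%E => //.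
  rewrite bernoulli_cylinder -EFinM -exprS -(bernoulli_cylinder (b :: s)).
  by rewrite cylinder_cons setIC.
- move=> _; apply: (@le_lt_trans _ _ 1%E); last by rewrite ltry.
  have mb := measurable_coordinate 0 b.
  apply: (le_trans _ (probability_le1 bernoulli_measure mb)).
  by rewrite le_eqVlt -[X in bernoulli_measure X]setTI eqxx.
Qed.
End bernoulli_measure.

(** * The invariant measure of the symbolic coding *)

Section bernoulli_ifs.
Context (R : realType) (lambda : R).
Hypothesis lambda_bounds : 0 < lambda < 1.
Local Notation space := (shift_space * measurableTypeR R)%type.
Local Notation phi := (bernoulli_ifs lambda).
Local Notation f := (lift_map phi).

Definition sgn (b : bool) : R := if b then 1 else -1.

Lemma bernoulli_ifsE (i : bool) (x : R) : phi i x = lambda * x + sgn i.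
Proof. by rewrite /bernoulli_ifs /sgn; case: i. Qed.

Lemma norm_sgn (b : bool) : `|sgn b| = 1.
Proof. by case: b; rewrite /sgn ?normrN normr1. Qed.

Lemma measurable_bernoulli_ifs (i : bool) : measurable_fun [set: measurableTypeR R]
  (phi i : measurableTypeR R -> measurableTypeR R).
Proof.
rewrite (_ : phi i = fun x => lambda * x + sgn i); last first.
  by apply/funext => x; rewrite bernoulli_ifsE.
apply: measurable_funD; last exact: measurable_cst.
by apply: measurable_funM => //; exact: measurable_cst.
Qed.

Lemma homo_bernoulli_ifs (i : bool) : {homo phi i : x y / x <= y}.
Proof.
move=> x y xy; rewrite !bernoulli_ifsE lerD2r ler_wpM2l//.
by case/andP: lambda_bounds => /ltW.
Qed.

Definition signs (w : shift_space) (j : nat) : R := sgn (w j) * lambda ^+ j.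

Lemma cvg_signs (w : shift_space) : cvgn (series (signs w)).
Proof.
case/andP: lambda_bounds => l0 l1.
apply: normed_cvg; apply: (@series_le_cvg _ _ (geometric 1 lambda)).
- by move=> n; exact: normr_ge0.
- by move=> n; rewrite /geometric/= mul1r exprn_ge0// ltW.
- move=> n; rewrite /signs /= normrM norm_sgn !mul1r ger0_norm//.
  by rewrite exprn_ge0// ltW.
- by apply: is_cvg_geometric_series; rewrite ger0_norm// ltW.
Qed.

(** The canonical projection of the system, written as the series of the terms [+- lambda ^+ j]. *)
Definition coding (w : shift_space) : measurableTypeR R := limn (series (signs w)).

Lemma series_signsS (w : shift_space) (k : nat) :
  series (signs w) k.+1 = phi (w 0%N) (series (signs (Defs.shift w)) k).
Proof.
rewrite bernoulli_ifsE /series /= big_nat_recl// {1}/signs expr0 mulr1 addrC.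
congr (_ + _); rewrite mulr_sumr; apply: eq_bigr => i _.
by rewrite /signs exprS mulrCA.
Qed.

Lemma coding_shift (w : shift_space) :
  coding w = phi (w 0%N) (coding (Defs.shift w)).
Proof.
have cw : series (signs w) @ \oo --> coding w by exact: cvg_signs.
have cs : series (signs (Defs.shift w)) @ \oo --> coding (Defs.shift w).
  exact: cvg_signs.
rewrite -cvg_shiftS in cw; apply: cvg_unique cw _ => //.
rewrite bernoulli_ifsE [X in X @ _](_ : _ = fun k =>
  lambda * series (signs (Defs.shift w)) k + sgn (w 0%N)); last first.
  by apply/funext => k; rewrite -bernoulli_ifsE -series_signsS.
by apply: cvgD; [apply: cvgMr|exact: cvg_cst].
Qed.

Lemma measurable_coding : measurable_fun [set: shift_space] coding.
Proof.
apply: (@measurable_fun_cvg _ _ _ _ (fun k w => series (signs w) k)); last first.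
  by move=> w _; exact: cvg_signs.
move=> k; rewrite /series /=; apply: measurable_sum => j.
apply: measurable_funM; last exact: measurable_cst.
apply: measurable_fun_ifT; [|exact: measurable_cst|exact: measurable_cst].
by apply: (measurable_fun_bool true); rewrite setTI; exact: measurable_coordinate.
Qed.

Lemma phi_word_mkseq (w : shift_space) (k : nat) (z : R) :
  phi_word phi (mkseq w k) z = series (signs w) k + lambda ^+ k * z.
Proof.
elim: k w => [|k IH] w; first by rewrite /series /= big_nil add0r mul1r.
rewrite mkseq_shift series_signsS /= -/(phi_word _ _ _) IH !bernoulli_ifsE.
by rewrite exprS; ring.
Qed.

Context (Lambda : set R).
Hypothesis Lambda_limit : limit_set phi Lambda.

Lemma limit_set_phi (i : bool) (x : R) : Lambda x -> Lambda (phi i x).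
Proof.
by have [_ _ LE] := Lambda_limit; move=> Lx; rewrite LE; exists i => //; exists x.
Qed.

Lemma limit_set_phi_word (s : seq bool) (x : R) :
  Lambda x -> Lambda (phi_word phi s x).
Proof. by move=> Lx; elim: s => //= b s IH; exact: limit_set_phi. Qed.

Lemma closed_limit_set : closed Lambda.
Proof. by have [cL _ _] := Lambda_limit; exact: compact_closed. Qed.

Lemma measurable_limit_set : measurable (Lambda : set (measurableTypeR R)).
Proof. exact: closed_measurable closed_limit_set. Qed.

(** The series is also the limit of the images [phi_word phi (mkseq w k) z] of a point [z] of the
    closed invariant set, because [lambda ^+ k * z] tends to 0. *)
Lemma coding_limit_set (w : shift_space) : Lambda (coding w).
Proof.
have [_ [z Lz] _] := Lambda_limit.
apply: (closed_cvg (F := \oo) (fun x => Lambda x) closed_limit_set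
  (u_ := fun k => phi_word phi (mkseq w k) z)).
  by near=> k; exact: limit_set_phi_word.
under eq_fun do rewrite phi_word_mkseq.
rewrite -[coding w]addr0; apply: cvgD; first exact: cvg_signs.
rewrite -(mul0r z); apply: cvgMl; apply: cvg_expr.
by case/andP: lambda_bounds => l0 l1; rewrite ger0_norm// ltW.
Unshelve. all: by end_near. Qed.

Definition coding_law : probability (measurableTypeR R) R :=
  distribution (bernoulli_measure R) (mfun_Sub (mem_set measurable_coding)).

(** The lift reads letters of the first coordinate to move the second, so the second depends on the
    past only. Taking it independent of the future letters, with the self-similar law, gives an
    invariant measure. *)
Definition bernoulli_lift : probability space R :=
  (bernoulli_measure R \x coding_law)%E.

Lemma bernoulli_liftX (A : set shift_space) (C : set (measurableTypeR R)) :
  measurable A -> measurable C ->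
  bernoulli_lift (A `*` C) = (bernoulli_measure R A * coding_law C)%E.
Proof. by move=> mA mC; exact: product_measure1E. Qed.

(** Split by the first letter: on each half [coding_shift] applies, and the shifted sequence is
    independent of that letter. *)
Lemma coding_law_self_similar (C : set (measurableTypeR R)) : measurable C ->
  coding_law C = ((2^-1)%:E * coding_law (phi true @^-1` C) +
                  (2^-1)%:E * coding_law (phi false @^-1` C))%E.
Proof.
move=> mC.
have mcod D : measurable D -> measurable (coding @^-1` D).
  move=> mD; rewrite -[X in measurable X]setTI.
  exact: (measurable_coding measurableT mD).
have mphi i : measurable (phi i @^-1` C : set (measurableTypeR R)).
  rewrite -[X in measurable X]setTI.
  exact: (measurable_bernoulli_ifs i measurableT mC).
have step i : bernoulli_measure R ([set w : shift_space | w 0%N = i] `&` coding @^-1` C) =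
    ((2^-1)%:E * coding_law (phi i @^-1` C))%E.
  have mA := mcod _ (mphi i).
  rewrite (_ : _ `&` _ = [set w : shift_space | w 0%N = i] `&`
    Defs.shift @^-1` (coding @^-1` (phi i @^-1` C))); first exact: bernoulli_shift.
  by apply/seteqP; split=> w /= [w0] cw; split=> //=; move: cw; rewrite (coding_shift w) w0.
rewrite -!step -measureU.
- rewrite -setIUl (_ : _ `|` _ = setT) ?setTI//.
  by apply/seteqP; split=> w //= _; case: (w 0%N); [left|right].
- by apply: measurableI; [exact: measurable_coordinate|exact: mcod].
- by apply: measurableI; [exact: measurable_coordinate|exact: mcod].
- by rewrite -subset0 => w /= [[-> _] []].
Qed.

(** It suffices to test rectangles. The preimage of a rectangle splits by the first letter into two
    rectangles, and their masses add up by self-similarity. *)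
Lemma bernoulli_lift_invariant (A : set space) : measurable A ->
  pushforward bernoulli_lift f A = bernoulli_lift A.
Proof.
pose m := pushforward_measure
  bernoulli_lift (measurable_lift measurable_bernoulli_ifs).
move=> mA; apply/esym; move: A mA.
have := @product_measure_unique _ _ _ _ R (bernoulli_measure R) coding_law m.
apply=> A C mA mC.
have mphi i : measurable (phi i @^-1` C : set (measurableTypeR R)).
  rewrite -[X in measurable X]setTI.
  exact: (measurable_bernoulli_ifs i measurableT mC).
have mS i : measurable ([set w : shift_space | w 0%N = i] `&` Defs.shift @^-1` A).
  apply: measurableI; first exact: measurable_coordinate.
  by rewrite -[X in measurable X]setTI; exact: (measurable_shift measurableT mA).
transitivity (bernoulli_lift (f @^-1` (A `*` C))) => //.
rewrite (_ : f @^-1` (A `*` C) =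
  ([set w : shift_space | w 0%N = true] `&` Defs.shift @^-1` A) `*` (phi true @^-1` C) `|`
  ([set w : shift_space | w 0%N = false] `&` Defs.shift @^-1` A) `*` (phi false @^-1` C)).
  set X := (X in X `|` _); set Y := (X in _ `|` X).
  transitivity (bernoulli_lift X + bernoulli_lift Y)%E.
    apply: measureU; [exact: measurableX|exact: measurableX|].
    by rewrite -subset0 => -[w x] [[[/= wt _] _] [[/= wf _] _]]; rewrite wt in wf.
  rewrite !bernoulli_liftX// !bernoulli_shift//.
  transitivity (bernoulli_measure R A * coding_law C)%E; last by [].
  rewrite (coding_law_self_similar mC) -!muleA ge0_muleDr ?mule_ge0//.
  by congr (_ + _)%E; exact: muleCA.
apply/seteqP; split=> [[w x]|[w x]] /=.
  by case E : (w 0%N) => -[]; [left|right].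
by move=> [[[-> ? ?]]|[[-> ? ?]]].
Qed.

Lemma bernoulli_lift_space : bernoulli_lift (lift_space Lambda) = 1%E.
Proof.
rewrite /lift_space bernoulli_liftX//; last first.
  exact: measurable_limit_set.
rewrite probability_setT mul1e /coding_law /distribution /pushforward/=.
rewrite (_ : coding @^-1` Lambda = setT) ?probability_setT//.
by apply/seteqP; split=> w // _; exact: coding_limit_set.
Qed.

Definition symbol (p : space) : 'I_2 := inord (nat_of_bool (p.1 0%N)).

Lemma symbolP (p : space) (i : 'I_2) : symbol p = i <-> p.1 0%N = (i == 1%R).
Proof.
rewrite /symbol; split=> [<-|->].
  by rewrite -val_eqE /= inordK; case: (p.1 0%N).
by apply/val_inj; rewrite /= inordK; case: i => -[|[|]].
Qed.

Lemma join_cell_symbol (k : nat) (a : k.-tuple 'I_2) :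
  join_cell f symbol a = cylinder (map (fun i : 'I_2 => i == 1%R) a) `*` setT.
Proof.
apply/seteqP; split=> [p h|p [+ _ j]].
  split=> //; rewrite /cylinder /mkset size_map size_tuple.
  apply: (@eq_from_nth _ false) => [|i]; rewrite size_mkseq ?size_map ?size_tuple//.
  move=> ik; rewrite nth_mkseq// (nth_map 0) ?size_tuple//.
  have /symbolP := h (Ordinal ik); rewrite iter_lift1 add0n => ->.
  by rewrite (tnth_nth 0).
rewrite /cylinder /mkset size_map size_tuple => /(congr1 (nth false ^~ j)).
rewrite nth_mkseq// (nth_map 0) ?size_tuple// => h.
by apply/symbolP; rewrite iter_lift1 add0n h (tnth_nth 0).
Qed.

(** The partition by the first letter has the cylinders of length [k] as joint cells, all of mass
    [2^-k], so its entropy is exactly [ln 2]. *)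
Lemma bernoulli_lift_entropy : ((ln 2)%:E <= measure_entropy f bernoulli_lift)%E.
Proof.
apply: ereal_sup_ubound; exists 2%N, symbol; split.
  move=> i.
  rewrite (_ : _ @^-1` _ = [set w : shift_space | w 0%N = (i == 1%R)] `*` setT).
    by apply: measurableX => //; exact: measurable_coordinate.
  by apply/seteqP; split=> p /=; [move=> /symbolP|move=> [? _]; apply/symbolP].
have join_ln2 k : join_entropy f bernoulli_lift symbol k = k%:R * ln 2.
  rewrite /join_entropy.
  have cellE (a : k.-tuple 'I_2) :
      fine (bernoulli_lift (join_cell f symbol a)) = 2^-1 ^+ k.
    rewrite join_cell_symbol bernoulli_liftX//; last exact: measurable_cylinder.
    by rewrite bernoulli_cylinder probability_setT mule1 size_map size_tuple.
  under eq_bigr do rewrite cellE.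
  rewrite sumr_const card_tuple card_ord exprVn lnV ?posrE ?exprn_gt0// lnXn//.
  rewrite mulrN mulNrn opprK -mulrnAl -[X in X * _]mulr_natr natrX mulVf ?mul1r.
    by rewrite mulr_natl.
  by rewrite expf_neq0.
congr EFin; apply/esym; apply: cvg_lim => //.
(* At [k = 0] the average is 0, so the sequence is constant only from [k = 1] on. *)
apply: cvg_near_cst; near=> k.
rewrite join_ln2 mulrA mulVf ?mul1r// pnatr_eq0 -lt0n.
by near: k; exact: nbhs_infty_gt.
Unshelve. all: by end_near. Qed.

Lemma max_entropy_letters (mu : probability space R) :
  max_entropy_measure f (lift_space Lambda) mu ->
  forall l (a : {ffun 'I_l -> bool}), law mu (letters l) a = 2^-1 ^+ l.
Proof.
move=> [[_ inv] hmax] l a; apply: (law_letters _ _ inv).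
- exact: measurable_bernoulli_ifs.
- exact: homo_bernoulli_ifs.
- apply: le_trans bernoulli_lift_entropy (hmax _ _); split.
    exact: bernoulli_lift_space.
  exact: bernoulli_lift_invariant.
Qed.

End bernoulli_ifs.

(** * Counting signed sums *)

Section signed_sums.
Context (R : realType).

(** The number of sign choices whose signed sum of [cs] lies in [[a, b]]; the interval is moved
    instead of accumulating the sum. *)
Fixpoint nsum (cs : seq R) (a b : R) : nat :=
  if cs is c :: cs' then (nsum cs' (a - c)%R (b - c)%R + nsum cs' (a + c)%R (b + c)%R)%N
  else nat_of_bool (a <= 0 <= b)%R.

Lemma nsum_scale (c : R) (cs : seq R) (a b : R) : 0 < c ->
  nsum [seq c * x | x <- cs] a b = nsum cs (a / c) (b / c).
Proof.
move=> c0; elim: cs a b => [|x cs IH] a b /=.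
  by rewrite ler_pdivrMr// mul0r ler_pdivlMr// mul0r.
by rewrite !IH !mulrDl !mulNr [c * x]mulrC mulfK// gt_eqF.
Qed.

(** Each choice of signs for the terms outside [ds] translates the interval; [T] lists these
    translations. *)
Lemma nsum_subseq (ds cs : seq R) : subseq ds cs -> exists T : seq R,
  size T = (2 ^ (size cs - size ds))%N /\
  forall a b, nsum cs a b = \sum_(t <- T) nsum ds (a - t) (b - t).
Proof.
elim: cs ds => [|c cs IH] ds.
  rewrite subseq0 => /eqP ->; exists [:: 0]; split=> // a b.
  by rewrite big_seq1 !subr0.
have skip : subseq ds cs -> exists T : seq R,
  size T = (2 ^ (size (c :: cs) - size ds))%N /\
  forall a b, nsum (c :: cs) a b = \sum_(t <- T) nsum ds (a - t) (b - t).
  move=> dscs; have [T [sT TE]] := IH _ dscs.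
  exists ([seq c + t | t <- T] ++ [seq - c + t | t <- T]); split.
    rewrite size_cat !size_map sT addnn -mul2n -expnS /= subSn//.
    exact: size_subseq.
  move=> a b; rewrite big_cat !big_map /= !TE; congr addn.
    by apply: eq_bigr => t _; rewrite !opprD !addrA.
  by apply: eq_bigr => t _; rewrite !opprD !addrA !opprK.
case: ds skip => [skip _|d ds skip]; first by apply: skip; exact: sub0seq.
rewrite /=; case: eqP => [->|_]; last exact: skip.
move=> /IH[T [sT TE]]; exists T; split=> // a b.
rewrite !TE -big_split; apply: eq_bigr => t _ /=.
by congr addn; congr nsum; ring.
Qed.

Lemma count_arith_prog (x h a b : R) (N : nat) : 0 < h -> a <= b ->
  h * (count (fun D => a <= x + h * D%:R <= b) (iota 0 N))%:R <= b - a + h.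
Proof.
move=> h0 ab.
(* The second bound records that the counted terms lie between [a] and the current end of the
   progression. It may fail before the first counted term, hence the alternative of a zero count. *)
set p := fun D => _; have : count p (iota 0 N) = 0%N \/
    h * (count p (iota 0 N))%:R <= b - a + h /\
    h * (count p (iota 0 N))%:R <= x + h * N%:R - a.
  elim: N => [|N IH]; first by left.
  rewrite -addn1 iotaD count_cat /= add0n addn0.
  have [pN|npN] := boolP (p N); last first.
    rewrite addn0; case: IH => [->|[h1 h2]]; [by left|right; split=> //].
    by rewrite natrD mulrDr mulr1; lra.
  right; move: pN => /andP[aN Nb].
  rewrite !natrD !mulrDr !mulr1; case: IH => [->|[h1 h2]].
    by rewrite mulr0; split; lra.
  by split; lra.
case=> [->|[]//]; rewrite mulr0; lra.
Qed.

Definition halves (m : nat) : seq R := mkseq (fun i => 2^-1 ^+ i) m.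

Lemma halvesS (m : nat) : halves m.+1 = 1 :: [seq 2^-1 * x | x <- halves m].
Proof.
rewrite /halves /mkseq /= expr0 (iotaDl 1 0 m) -!map_comp; congr cons.
by apply: eq_map => i /=; rewrite exprS.
Qed.

(** The signed sums of [1, 1/2, ..., 2^-(m-1)] form a progression of step [4 * 2^-m] starting at
    [2 * 2^-m - 2], each reached by one choice of signs. A leading minus gives its lower half, a
    leading plus its upper half. *)
Lemma nsum_halves (m : nat) (a b : R) : nsum (halves m) a b =
  count (fun D => a <= 2 * 2^-1 ^+ m - 2 + 4 * 2^-1 ^+ m * D%:R <= b) (iota 0 (2 ^ m)).
Proof.
elim: m a b => [|m IH] a b.
  by rewrite expn0 /= expr0 !mulr1 mulr0 subrr addr0 addn0.
rewrite halvesS /= !nsum_scale ?invr_gt0// !IH expnS mul2n -addnn iotaD count_cat.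
rewrite addnC; congr addn.
  apply: eq_count => D /=; rewrite exprS.
  by apply/idP/idP => /andP[? ?]; apply/andP; split; lra.
rewrite add0n -[X in _ = count _ (iota X _)]addn0 iotaDl count_map.
apply: eq_count => D /=; rewrite natrD natrX exprS.
have : 2^-1 ^+ m * 2 ^+ m = 1 :> R by rewrite -exprMn mulVf// expr1n.
move: (2^-1 ^+ m) (2 ^+ m) => y z yz.
have -> : 4 * (2^-1 * y) * (z + D%:R) = 2 * (y * z) + 2 * y * D%:R by field.
rewrite yz mulr1.
by apply/idP/idP => /andP[? ?]; apply/andP; split; lra.
Qed.

Lemma nsum_halves_le (m : nat) (a b : R) : a <= b ->
  (nsum (halves m) a b)%:R <= (b - a) * 2 ^+ m / 4 + 1.
Proof.
move=> ab; rewrite nsum_halves.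
have h0 : 0 < 4 * 2^-1 ^+ m :> R by rewrite mulr_gt0// exprn_gt0.
rewrite -(ler_pM2l h0) (le_trans (count_arith_prog _ _ h0 ab))//.
rewrite mulrDr mulr1 lerD2r le_eqVlt; apply/orP; left; apply/eqP.
by rewrite exprVn; field; rewrite expf_neq0.
Qed.

End signed_sums.

(** * Words whose composition sends 0 into an interval *)

Section word_count.
Context (R : realType) (lambda : R) (n : nat).
Hypothesis lambda_bounds : 0 < lambda < 1.
Hypothesis n0 : (0 < n)%N.
Hypothesis lambdaXn : lambda ^+ n = 2^-1.
Local Notation phi := (bernoulli_ifs lambda).

Lemma subseq_halves (m k : nat) : (n * m <= k)%N ->
  subseq (halves R m) (mkseq (fun i => lambda ^+ i) k).
Proof.
move=> /subnKC <-; rewrite /mkseq iotaD map_cat.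
apply: subseq_trans (prefix_subseq _ _).
elim: m => [|m IH]; first exact: sub0seq.
rewrite mulnSr iotaD map_cat /halves mkseqS -cats1.
apply: cat_subseq => //; rewrite sub1seq; apply/mapP; exists (n * m)%N.
  by rewrite mem_iota add0n leqnn /= -[X in (X < _)%N]addn0 ltn_add2l.
by rewrite exprM lambdaXn.
Qed.

Lemma sum_tupleS (k : nat) (F : k.+1.-tuple bool -> nat) :
  (\sum_t F t = \sum_(t : k.-tuple bool) F [tuple of true :: t] +
               \sum_(t : k.-tuple bool) F [tuple of false :: t])%N.
Proof.
rewrite (reindex (fun p : bool * k.-tuple bool => [tuple of p.1 :: p.2])) /=.
  rewrite -(pair_bigA _ (fun b (t : k.-tuple bool) => F [tuple of b :: t])) /=.
  by rewrite big_bool.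
exists (fun t => (thead t, [tuple of behead t])) => [[b t] _|t _] /=.
  by congr pair; apply: val_inj.
by rewrite -tuple_eta.
Qed.

Lemma nsum_words (k : nat) (a b : R) :
  nsum (mkseq (fun i => lambda ^+ i) k) a b =
  \sum_(t : k.-tuple bool) nat_of_bool (a <= phi_word phi t 0 <= b)%R.
Proof.
case/andP: lambda_bounds => l0 l1.
elim: k a b => [|k IH] a b.
  rewrite (big_pred1 [tuple]) => [|t]; first by [].
  by rewrite [t]tuple0; apply/esym/eqP.
rewrite sum_tupleS.
have -> : mkseq (fun i => lambda ^+ i) k.+1 =
    1 :: [seq lambda * x | x <- mkseq (fun i => lambda ^+ i) k].
  rewrite /mkseq /= expr0 (iotaDl 1 0 k) -!map_comp; congr cons.
  by apply: eq_map => i /=; rewrite exprS.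
rewrite /= !nsum_scale// !IH; congr addn; apply: eq_bigr => t _ /=.
  rewrite -/(phi_word _ _ _) !(ler_pdivrMr, ler_pdivlMr)// lerBlDr lerBrDr.
  by rewrite [_ * lambda]mulrC.
rewrite -/(phi_word _ _ _) !(ler_pdivrMr, ler_pdivlMr)// lerBrDr lerBlDr.
by rewrite [_ * lambda]mulrC.
Qed.

(** The powers with exponents [0, n, ..., n * (m - 1)] are the halves; the signs of the other
    [k - m] terms are chosen freely, and each choice only translates the interval. *)
Lemma word_count_le (k m : nat) (a b : R) : (n * m <= k)%N -> a <= b ->
  (\sum_(t : k.-tuple bool) nat_of_bool (a <= phi_word phi t 0 <= b)%R)%:R <=
  2 ^+ (k - m) * ((b - a) * 2 ^+ m / 4 + 1).
Proof.
move=> nmk ab; rewrite -nsum_words.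
have [T [sT ->]] := nsum_subseq (subseq_halves nmk).
rewrite natr_sum (@le_trans _ _ (\sum_(t <- T) ((b - a) * 2 ^+ m / 4 + 1)))//.
  apply: ler_sum => t _; apply: le_trans (nsum_halves_le _ _) _.
    by rewrite lerD2r.
  by rewrite opprB addrA subrK.
rewrite big_const_seq count_predT sT !size_mkseq iter_addr addr0.
by rewrite -[_ *+ (2 ^ _)%N]mulr_natl natrX.
Qed.

End word_count.

(** * Absolute continuity *)

(** Lebesgue measure is an infimum over countable covers by half-open intervals, so a bound on these
    intervals passes to every measurable set by subadditivity. *)
Lemma measure_le_lebesgue (R : realType)
    (m : {measure set (measurableTypeR R) -> \bar R}) (C : R) : 0 < C ->
  (forall a b : R, a < b -> (m `]a, b]%classic <= (C * (b - a))%:E)%E) ->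
  forall A : set (measurableTypeR R), measurable A ->
  (m A <= C%:E * lebesgue_measure A)%E.
Proof.
move=> C0 mitv A mA.
rewrite muleC -lee_pdivrMr//.
rewrite /lebesgue_measure /lebesgue_stieltjes_measure /measure_extension /mu_ext.
apply: le_ereal_inf_tmp => _ [F [mF AF] <-].
rewrite lee_pdivrMr// muleC -nneseriesZl; last by move=> k _; exact: wlength_ge0.
have mF' k : measurable (F k : set (measurableTypeR R)).
  exact: sub_sigma_algebra (mF k).
apply: (le_trans (measure_sigma_subadditive m mF' mA AF)).
apply: lee_nneseries => // k _.
have /ocitvP[->|[[a b] ab ->]] := mF k.
  by rewrite measure0; apply: mule_ge0; [rewrite lee_fin ltW|exact: wlength_ge0].
apply: (le_trans (mitv _ _ ab)); rewrite EFinM le_eqVlt; apply/orP; left.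
by apply/eqP; congr (_ * _)%E; exact/esym/wlength_itv_bnd/ltW.
Qed.

(** * Joint law of the word read and the point reached *)

Section slices.
Context (R : realType) (lambda : R) (n : nat).
Hypothesis lambda_bounds : 0 < lambda < 1.
Hypothesis n0 : (0 < n)%N.
Hypothesis lambdaXn : lambda ^+ n = 2^-1.
Local Notation space := (shift_space * measurableTypeR R)%type.
Local Notation phi := (bernoulli_ifs lambda).
Local Notation f := (lift_map phi).
Context (Lambda : set R) (B : R).
Hypothesis mLambda : measurable (Lambda : set (measurableTypeR R)).
Hypothesis LambdaB : forall x, Lambda x -> `|x| <= B.
Context (mu : probability space R).
Hypothesis inv : forall A, measurable A -> pushforward mu f A = mu A.
Hypothesis muLambda : mu (lift_space Lambda) = 1%E.
Hypothesis uniform : forall l a, law mu (letters l) a = 2^-1 ^+ l.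

Lemma phi_word_affine (s : seq bool) (x : R) :
  phi_word phi s x = phi_word phi s 0 + lambda ^+ size s * x.
Proof.
elim: s => [|b s IH] /=; first by rewrite add0r mul1r.
by rewrite -!/(phi_word _ _ _) IH !bernoulli_ifsE exprS; ring.
Qed.

Lemma iter_lift_word (k : nat) (p : space) :
  (iter k f p).2 = phi_word phi (rev (mkseq p.1 k)) p.2.
Proof.
elim: k => [//|k IH].
by rewrite iter_lift2S IH mkseqS rev_rcons.
Qed.

Definition word_set (s : seq bool) : set space := [set p | mkseq p.1 (size s) = s].

Lemma word_set_letters (s : seq bool) :
  word_set s = letters (size s) @^-1` [set [ffun i : 'I_(size s) => nth false s i]].
Proof.
apply/seteqP; split=> p; rewrite /word_set /=.
  move=> ps; apply/ffunP => i; rewrite !ffunE.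
  by have := congr1 (nth false ^~ i) ps; rewrite nth_mkseq.
move=> /ffunP ps; apply: (@eq_from_nth _ false); rewrite size_mkseq// => i ik.
by rewrite nth_mkseq//; have := ps (Ordinal ik); rewrite !ffunE.
Qed.

Lemma measurable_word_set (s : seq bool) : measurable (word_set s).
Proof. by rewrite word_set_letters; exact: discrete_letters. Qed.

Lemma prob_word_set (s : seq bool) : prob mu (word_set s) = 2^-1 ^+ size s.
Proof. by rewrite word_set_letters; exact: uniform. Qed.

Lemma measurable_lift_space : measurable (lift_space Lambda).
Proof. exact: measurableX. Qed.

Lemma prob_lift_space (A : set space) : measurable A ->
  prob mu (A `&` lift_space Lambda) = prob mu A.
Proof.
move=> mA; apply/le_anti/andP; split.
  by apply: le_prob => //; apply: measurableI => //; exact: measurable_lift_space.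
have mL := measurable_lift_space.
have mC : measurable (~` lift_space Lambda) by exact: measurableC.
have mAL : measurable (A `&` lift_space Lambda) by exact: measurableI.
have C0 : prob mu (~` lift_space Lambda) = 0.
  by rewrite /prob probability_setC// muLambda subee.
apply: le_trans (_ : prob mu ((A `&` lift_space Lambda) `|` ~` lift_space Lambda) <= _).
  apply: le_prob => //; first exact: measurableU.
  by move=> p Ap; have [Lp|nLp] := pselect (lift_space Lambda p); [left|right].
by apply: le_trans (prob_setU_le _ _ _) _; rewrite // C0 addr0.
Qed.

(** The starting point is kept in the limit set, which bounds its influence on the point reached
    after reading [s]. *)
Definition slice (s : seq bool) (A : set R) : set space :=
  word_set s `&` lift_space Lambda `&` (snd \o iter (size s) f) @^-1` A.

Let mphi i : measurable_fun [set: measurableTypeR R]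
  (phi i : measurableTypeR R -> measurableTypeR R).
Proof. exact: measurable_bernoulli_ifs. Qed.

Lemma measurable_snd_iter (k : nat) :
  measurable_fun [set: space] (snd \o iter k f : space -> measurableTypeR R).
Proof. exact: (measurableT_comp measurable_snd (measurable_iter_lift mphi k)). Qed.

Lemma measurable_slice (s : seq bool) (A : set (measurableTypeR R)) :
  measurable A -> measurable (slice s A).
Proof.
move=> mA; apply: measurableI.
  by apply: measurableI; [exact: measurable_word_set|exact: measurable_lift_space].
rewrite -[X in measurable X]setTI.
exact: (measurable_snd_iter (size s) measurableT mA).
Qed.

(** Invariance allows [p = n * m] further letters to be read before [s]. The point at which [s]
    begins is then, up to [lambda ^+ p * B], the signed sum of the past word [t]. Only the words
    counted by [word_count_le] can lead into the interval, and each word of length [p + k] has mass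
    [2^-(p + k)]. *)
Lemma prob_slice_itv_le (s : seq bool) (a b : R) (m : nat) : a < b ->
  prob mu (slice s `]a, b]%classic) <= 2^-1 ^+ size s *
    ((b - a) / lambda ^+ size s / 4 + 2^-1 ^+ m * (B / 2 + 1)).
Proof.
case/andP: lambda_bounds => l0 l1 ab; set k := size s; set p := (n * m)%N.
have B0 : 0 <= B.
  have [|nL] := pselect (exists x, Lambda x).
    by move=> [x /LambdaB]; exact: le_trans.
  have : lift_space Lambda = set0.
    by rewrite -subset0 => -[w x] [_ Lx]; apply: nL; exists x.
  by move: muLambda => /[swap] ->; rewrite measure0 => /eqP; rewrite lt_eqF.
have lk0 : 0 < lambda ^+ k by rewrite exprn_gt0.
have lp : lambda ^+ p = 2^-1 ^+ m by rewrite /p exprM lambdaXn.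
(* The preimage of the interval under the composition for [s], widened by the largest effect of the
   unknown starting point. *)
pose a' := (a - phi_word phi (rev s) 0) / lambda ^+ k - lambda ^+ p * B.
pose b' := (b - phi_word phi (rev s) 0) / lambda ^+ k + lambda ^+ p * B.
have ab' : a' <= b'.
  rewrite /a' /b' lerD//; last by rewrite ge0_cp// mulr_ge0// exprn_ge0// ltW.
  by rewrite ler_pM2r ?invr_gt0// lerD2r ltW.
have b'a' : b' - a' = (b - a) / lambda ^+ k + 2^-1 ^+ m * B * 2.
  by rewrite /a' /b' lp; field; rewrite gt_eqF.
pose good (t : p.-tuple bool) := (a' <= phi_word phi t 0 <= b')%R.
(* The word [t] lists the past with the most recent letter first, as compositions require, so the
   letters in order of reading are [rev t ++ s]. *)
pose W (t : p.-tuple bool) := if good t then word_set (rev t ++ s) else set0.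
have mW t : measurable (W t).
  by rewrite /W; case: ifP => // _; exact: measurable_word_set.
have ms := measurable_slice s (measurable_itv `]a, b]).
have mp := measurable_preimage_iter mphi p ms.
rewrite -(prob_iter_lift mphi inv p ms) -prob_lift_space//.
apply: (@le_trans _ _ (prob mu (\big[setU/set0]_t W t))).
  apply: le_prob.
  - by apply: measurableI => //; exact: measurable_lift_space.
  - by apply: bigsetU_measurable.
  - move=> q [[[qs _] qab] [_ Lq]]; rewrite -bigcup_seq.
    have st : size (rev (mkseq q.1 p)) == p by rewrite size_rev size_mkseq.
    pose t : p.-tuple bool := Tuple st.
    exists t; first by rewrite /= mem_index_enum.
    have gt : good t.
      move: qab; rewrite /preimage /= in_itv /= iter_lift_word [mkseq _ _]qs.
      rewrite iter_lift_word phi_word_affine size_rev -/k.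
      rewrite [phi_word phi (rev (mkseq q.1 p)) _]phi_word_affine (eqP st).
      rewrite -/(tval t); set x : R := q.2; set S := phi_word phi (tval t) 0.
      set c := phi_word phi (rev s) 0 => /andP[h1 h2].
      have /ler_normlP[xB Bx] : `|lambda ^+ p * x| <= lambda ^+ p * B.
        rewrite normrM ger0_norm ?exprn_ge0 ?(ltW l0)//.
        by rewrite ler_wpM2l ?exprn_ge0 ?(ltW l0)//; exact: LambdaB.
      have e1 : (a - c) / lambda ^+ k <= S + lambda ^+ p * x.
        by rewrite ler_pdivrMr// [_ * lambda ^+ k]mulrC; lra.
      have e2 : S + lambda ^+ p * x <= (b - c) / lambda ^+ k.
        by rewrite ler_pdivlMr// [_ * lambda ^+ k]mulrC; lra.
      by rewrite /good -/S /a' /b' -/c; apply/andP; split; lra.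
    rewrite /W gt /word_set /= revK size_cat size_mkseq /mkseq iotaD map_cat add0n.
    congr cat; rewrite -[RHS]qs -[X in iota X _]addn0 iotaDl -map_comp.
    by apply: eq_map => i /=; rewrite iter_lift1 addnC.
apply: (le_trans (prob_bigsetU_le mu mW)).
rewrite (eq_bigr (fun t => 2^-1 ^+ (p + k) * (nat_of_bool (good t))%:R)); last first.
  move=> t _; rewrite /W; case: ifP => _ /=; last by rewrite mulr0 /prob measure0.
  by rewrite mulr1 prob_word_set size_cat size_rev size_tuple.
rewrite -mulr_sumr -natr_sum.
have := word_count_le lambda_bounds n0 lambdaXn (leqnn p) ab'.
rewrite -(ler_pM2l (_ : 0 < 2^-1 ^+ (p + k))) ?exprn_gt0// => /le_trans; apply.
rewrite b'a' le_eqVlt; apply/orP; left; apply/eqP.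
have mp' : (m <= p)%N by rewrite /p leq_pmull.
rewrite exprD mulrAC -[X in 2^-1 ^+ X](subnK mp') exprD !exprVn.
by field; rewrite !expf_neq0//= gt_eqF.
Qed.

Definition slice_density (k : nat) : R := (4 * (2 * lambda) ^+ k)^-1.

Lemma slice_density_gt0 (k : nat) : 0 < slice_density k.
Proof.
case/andP: lambda_bounds => l0 _.
by rewrite invr_gt0 mulr_gt0// exprn_gt0// mulr_gt0.
Qed.

(** Let the length of the past grow: the error term [2^-m * (B / 2 + 1)] vanishes. *)
Lemma prob_slice_itv (s : seq bool) (a b : R) : a < b ->
  prob mu (slice s `]a, b]%classic) <= slice_density (size s) * (b - a).
Proof.
case/andP: lambda_bounds => l0 l1 ab; set k := size s.
have lim_itv : (fun m => 2^-1 ^+ k * ((b - a) / lambda ^+ k / 4 + 2^-1 ^+ m * (B / 2 + 1)))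
    @ \oo --> slice_density k * (b - a).
  have -> : slice_density k * (b - a) =
      2^-1 ^+ k * ((b - a) / lambda ^+ k / 4 + 0 * (B / 2 + 1)).
    rewrite mul0r addr0 /slice_density exprMn exprVn.
    by field; rewrite !expf_neq0//= gt_eqF.
  apply: cvgMr; apply: cvgD; first exact: cvg_cst.
  by apply: cvgMl; apply: cvg_expr; rewrite ger0_norm// invf_lt1// ltr1n.
rewrite -(cvg_lim _ lim_itv)//; apply: limr_ge; first by apply/cvg_ex; eexists; exact: lim_itv.
by near=> m; exact: prob_slice_itv_le.
Unshelve. all: by end_near. Qed.

Lemma slice_le_lebesgue (s : seq bool) (A : set (measurableTypeR R)) : measurable A ->
  (mu (slice s A) <= (slice_density (size s))%:E * lebesgue_measure A)%E.
Proof.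
have mE : measurable (word_set s `&` lift_space Lambda).
  by apply: measurableI; [exact: measurable_word_set|exact: measurable_lift_space].
pose m := pushforward_measure
  (mrestr mu mE) (measurable_snd_iter (size s)).
have mE' C : m C = mu (slice s C).
  by rewrite /slice setIC.
move=> mA; rewrite -mE'; apply: measure_le_lebesgue mA.
  exact: slice_density_gt0.
move=> a b ab; rewrite mE' -probE; last first.
  by apply: measurable_slice; exact: measurable_itv.
by rewrite lee_fin; exact: prob_slice_itv.
Qed.

(** The slice of the empty word is the part of the preimage over the limit set, and that part
    carries all the mass. *)
Lemma pushforward_snd_dominated : pushforward mu snd `<< (@lebesgue_measure R).
Proof.
move=> A A0 C mC CA; have C0 := A0 C mC CA.
have msnd : measurable (snd @^-1` C : set space).
  rewrite -[X in measurable X]setTI.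
  exact: (@measurable_snd _ _ shift_space (measurableTypeR R) measurableT _ mC).
rewrite /pushforward -probE// -prob_lift_space// probE//; last first.
  by apply: measurableI => //; exact: measurable_lift_space.
apply/eqP; rewrite eq_le measure_ge0 andbT.
have := slice_le_lebesgue [::] mC; rewrite C0 mule0; apply: le_trans.
rewrite le_measure ?inE//.
- by apply: measurableI => //; exact: measurable_lift_space.
- exact: measurable_slice.
- by move=> p [Cp Lp]; split.
Qed.

End slices.

(** * Overlaps *)

Lemma Rintegral_discrete d (T : measurableType d) (R : realType)
    (mu : probability T R) (D : set T) (F : finType) (X : T -> F) (h : F -> R) :
  measurable D -> discrete_rv X -> (forall a, 0 <= h a) ->
  \int[mu]_(p in D) h (X p) = \sum_a h a * prob mu (D `&` X @^-1` [set a]).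
Proof.
move=> mD mX h0; rewrite /Rintegral.
have -> : (\int[mu]_(p in D) (h (X p))%:E =
    \int[mu]_(p in D) \sum_a ((h a)%:E * (\1_(X @^-1` [set a]) p)%:E))%E.
  apply: eq_integral => p _.
  rewrite (bigD1 (X p))//= indicE mem_set//= mule1 big1 ?adde0// => a aX.
  rewrite indicE memNset ?mule0//= => Xa; by rewrite Xa eqxx in aX.
rewrite ge0_integral_sum//; first last.
- by move=> a p _; rewrite mule_ge0// lee_fin.
- move=> a; apply: measurable_funeM; apply/measurable_EFinP.
  exact: measurable_indic.
rewrite (eq_bigr (fun a => (h a * prob mu (D `&` X @^-1` [set a]))%:E)).
  by rewrite sumEFin.
move=> a _; rewrite ge0_integralZl//; [|exact/measurable_EFinP/measurable_indic|exact: h0].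
rewrite integral_indic// EFinM probE; last exact: measurableI.
by rewrite setIC.
Qed.

Section overlaps.
Context (R : realType) (lambda : R) (n : nat).
Hypothesis lambda_bounds : 0 < lambda < 1.
Hypothesis n0 : (0 < n)%N.
Hypothesis lambdaXn : lambda ^+ n = 2^-1.
Local Notation space := (shift_space * measurableTypeR R)%type.
Local Notation phi := (bernoulli_ifs lambda).
Local Notation f := (lift_map phi).
Context (Lambda : set R) (B : R).
Hypothesis Lambda_limit : limit_set phi Lambda.
Hypothesis LambdaB : forall x, Lambda x -> `|x| <= B.
Context (mu : probability space R).
Hypothesis inv : forall A, measurable A -> pushforward mu f A = mu A.
Hypothesis muLambda : mu (lift_space Lambda) = 1%E.
Hypothesis uniform : forall l a, law mu (letters l) a = 2^-1 ^+ l.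

(** The set of covering words is recorded, not only its size: a point reached by reading a word must
    have that word in this set, which limits the slices meeting a given cell. *)
Definition covering (k : nat) (y : measurableTypeR R) : {ffun k.-tuple bool -> bool} :=
  [ffun eta : k.-tuple bool =>
    `[< exists2 z, Lambda z & y = phi_word phi (rev eta) z >]].

Lemma overlap_countE (k : nat) (p : space) :
  overlap_count phi Lambda k p.1 p.2 = #|[pred eta | covering k (iter k f p).2 eta]|.
Proof.
apply: eq_card => eta; rewrite iter_lift_word inE /= ffunE.
apply/idP/idP => [/set_mem/asboolP h|/asboolP h]; first exact/asboolP.
by apply/mem_set/asboolP.
Qed.

Lemma continuous_phi_word (s : seq bool) : continuous (phi_word phi s : R -> R).
Proof.
have -> : (phi_word phi s : R -> R) = (fun x => phi_word phi s 0 + lambda ^+ size s * x).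
  by apply/funext => x; exact: phi_word_affine.
by move=> x; apply: cvgD; [exact: cvg_cst|apply: cvgMr; exact: cvg_id].
Qed.

Lemma measurable_phi_word_image (s : seq bool) :
  measurable (phi_word phi s @` Lambda : set (measurableTypeR R)).
Proof.
have [cL _ _] := Lambda_limit.
apply: closed_measurable; apply: compact_closed => //.
apply: continuous_compact cL; apply: continuous_subspaceT.
exact: continuous_phi_word.
Qed.

Lemma discrete_covering (k : nat) : discrete_rv (covering k).
Proof.
apply: (@discrete_rv_ffun _ (measurableTypeR R) (k.-tuple bool) bool
  (fun eta y => `[< exists2 z, Lambda z & y = phi_word phi (rev eta) z >])) => eta.
apply: discrete_rv_bool.
have -> : [set y | `[< exists2 z, Lambda z & y = phi_word phi (rev eta) z >]] =
    phi_word phi (rev eta) @` Lambda.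
  apply/seteqP; split=> y /= => [/asboolP[z Lz ->]|[z Lz <-]];
    by [exists z|apply/asboolP; exists z].
exact: measurable_phi_word_image.
Qed.

(** If the composition for a word sends some point of the limit set to [y], it sends 0 within
    [lambda ^+ k * B] of [y]; [word_count_le] applies with [m = k %/ n]. *)
Lemma covering_card_le (k : nat) (y : R) :
  (#|[pred eta | covering k y eta]|)%:R <= (B + 2) * (2 * lambda) ^+ k.
Proof.
case/andP: lambda_bounds => l0 l1.
have B0 : 0 <= B.
  by have [_ [x /LambdaB + _]] := Lambda_limit; exact: le_trans.
have lk0 : 0 < lambda ^+ k by rewrite exprn_gt0.
set m := (k %/ n)%N.
have nmk : (n * m <= k)%N by rewrite mulnC leq_trunc_div.
pose a := y - lambda ^+ k * B; pose b := y + lambda ^+ k * B.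
have ab : a <= b by rewrite /a /b lerD2l ge0_cp// mulr_ge0// ltW.
apply: (@le_trans _ _ (\sum_(t : k.-tuple bool)
    nat_of_bool (a <= phi_word phi t 0 <= b)%R)%:R).
  rewrite ler_nat -sum1_card.
  rewrite [leqRHS](reindex (fun t : k.-tuple bool => [tuple of rev t])) /=; last first.
    by exists (fun t : k.-tuple bool => [tuple of rev t]) => t _; apply: val_inj; rewrite /= revK.
  rewrite big_mkcond /=; apply: leq_sum => t _; case: ifP => //.
  rewrite inE /= ffunE => /asboolP[z Lz yE].
  rewrite /a /b yE [phi_word phi _ z]phi_word_affine size_rev size_tuple.
  have /ler_normlP[zB Bz] : `|lambda ^+ k * z| <= lambda ^+ k * B.
    by rewrite normrM ger0_norm ?(ltW lk0)// ler_wpM2l ?(ltW lk0)//; exact: LambdaB.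
  by rewrite lt0b; apply/andP; split; lra.
apply: (le_trans (word_count_le lambda_bounds n0 lambdaXn nmk ab)).
have -> : b - a = 2 * lambda ^+ k * B by rewrite /a /b; ring.
have mk : (m <= k)%N by rewrite (leq_trans _ nmk)// leq_pmull.
have e2m : lambda ^+ (n * m) * 2 ^+ m = 1.
  by rewrite exprM lambdaXn -exprMn mulVf// expr1n.
have m20 : 0 < 2 ^+ m :> R by rewrite exprn_gt0.
(* By the choice of [m], the product [lambda ^+ k * 2 ^+ m] lies between [1/2] and 1; the lower end
   absorbs the additive 1 of the count. *)
have lkm : lambda ^+ k * 2 ^+ m <= 1.
  by rewrite -[leRHS]e2m ler_pM2r// ler_wiXn2l// ltW.
have klm : 1 <= 2 * (lambda ^+ k * 2 ^+ m).
  rewrite -[leLHS]e2m mulrA ler_pM2r// [in leRHS](divn_eq k n) -/m mulnC exprD mulrCA.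
  rewrite ler_peMr ?exprn_ge0 ?(ltW l0)//.
  rewrite -(ler_pM2l (_ : 0 < 2^-1)) ?invr_gt0// mulr1 mulKf// -lambdaXn.
  by rewrite ler_wiXn2l ?(ltW l0) ?(ltW l1)// ltnW// ltn_mod.
have e2k : 2 ^+ k = 2 ^+ (k - m) * 2 ^+ m :> R by rewrite -exprD subnK.
have km0 : 0 < 2 ^+ (k - m) :> R by rewrite exprn_gt0.
rewrite exprMn e2k.
rewrite [leRHS](_ : _ = 2 ^+ (k - m) * ((B + 2) * (lambda ^+ k * 2 ^+ m))); last by ring.
rewrite ler_pM2l//.
rewrite [X in X + 1](_ : _ = B / 2 * (lambda ^+ k * 2 ^+ m)); last by field.
by move: lkm klm; move: (lambda ^+ k * 2 ^+ m) => z *; nra.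
Qed.

End overlaps.

(** * Integral of the logarithm of the overlap count *)

Section overlap_bounds.
Context (R : realType) (lambda : R) (n : nat).
Hypothesis lambda_bounds : 0 < lambda < 1.
Hypothesis n0 : (0 < n)%N.
Hypothesis lambdaXn : lambda ^+ n = 2^-1.
Local Notation space := (shift_space * measurableTypeR R)%type.
Local Notation phi := (bernoulli_ifs lambda).
Local Notation f := (lift_map phi).
Context (Lambda : set R) (B : R).
Hypothesis Lambda_limit : limit_set phi Lambda.
Hypothesis LambdaB : forall x, Lambda x -> `|x| <= B.
Context (mu : probability space R).
Hypothesis inv : forall A, measurable A -> pushforward mu f A = mu A.
Hypothesis muLambda : mu (lift_space Lambda) = 1%E.
Hypothesis uniform : forall l a, law mu (letters l) a = 2^-1 ^+ l.

Let mLambda : measurable (Lambda : set (measurableTypeR R)).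
Proof. exact: measurable_limit_set Lambda_limit. Qed.

Local Notation cell k T := (covering lambda Lambda k @^-1` [set T]).
Local Notation orbit_covering k :=
  (covering lambda Lambda k \o (snd \o iter k f : space -> measurableTypeR R)).
Local Notation card_of T := (#|[pred eta | T eta]|).

Lemma measurable_cell (k : nat) (T : {ffun k.-tuple bool -> bool}) :
  measurable (cell k T : set (measurableTypeR R)).
Proof. exact: (discrete_covering Lambda_limit T). Qed.

Lemma discrete_orbit_covering (k : nat) : discrete_rv (orbit_covering k).
Proof.
move=> T; rewrite -[X in measurable X]setTI.
exact: (measurable_snd_iter lambda k measurableT (measurable_cell T)).
Qed.

Lemma cell_subset (k : nat) (T : {ffun k.-tuple bool -> bool}) :
  (0 < card_of T)%N -> cell k T `<=` `[- B, B]%classic.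
Proof.
move=> /card_gt0P[eta]; rewrite inE /= => Teta y /= yT.
move: Teta; rewrite -yT ffunE => /asboolP[z Lz ->] /=.
rewrite in_itv/= -ler_norml; apply: LambdaB.
exact: (limit_set_phi_word Lambda_limit).
Qed.

(** These cells are disjoint and lie in [[- B, B]]. The cell of points covered by no word is left
    out, as its Lebesgue measure is infinite. *)
Lemma sum_lebesgue_cell (k : nat) :
  (\sum_(T : {ffun k.-tuple bool -> bool} | (0 < card_of T)%N)
    lebesgue_measure (cell k T : set (measurableTypeR R)) <= (2 * B)%:E)%E.
Proof.
have B0 : 0 <= B.
  by have [_ [x /LambdaB + _]] := Lambda_limit; exact: le_trans.
have mcov := discrete_covering Lambda_limit (k := k).
rewrite -(measure_preimage (@lebesgue_measure R)
  (fun T : {ffun k.-tuple bool -> bool} => (0 < card_of T)%N) mcov).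
apply: (@le_trans _ _ (lebesgue_measure (`[- B, B]%classic : set R))).
  apply: le_measure; rewrite ?inE.
  - exact: discrete_rv_preimage.
  - exact: measurable_itv.
  - by move=> y /= yT; apply: cell_subset yT _ _.
rewrite lebesgue_measure_itv/= lte_fin; case: ifP => _.
  by rewrite -EFinD lee_fin; lra.
by rewrite lee_fin mulr_ge0.
Qed.

(** The word that leads to a point of the cell belongs to [T], so the event is a union of
    [card_of T] slices, each bounded by [slice_le_lebesgue]. *)
Lemma law_covering_le (k : nat) (T : {ffun k.-tuple bool -> bool}) :
  ((law mu (orbit_covering k) T)%:E <=
   ((card_of T)%:R * slice_density lambda k)%:E *
   lebesgue_measure (cell k T : set (measurableTypeR R)))%E.
Proof.
pose W (s : k.-tuple bool) :=
  if T s then slice lambda Lambda s (cell k T) else set0.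
have mW s : measurable (W s).
  rewrite /W; case: ifP => // _; apply: measurable_slice => //.
  exact: measurable_cell.
have mY := discrete_orbit_covering T.
rewrite /law -(prob_lift_space mLambda muLambda)//.
have mYL : measurable (orbit_covering k @^-1` [set T] `&` lift_space Lambda).
  by apply: measurableI => //; exact: measurable_lift_space.
apply: (@le_trans _ _ (\sum_s prob mu (W s))%:E).
  rewrite lee_fin; apply: le_trans (prob_bigsetU_le mu mW).
  apply: le_prob => //; first exact: bigsetU_measurable.
  move=> p [/= pT Lp]; rewrite -bigcup_seq.
  have sp : size (mkseq p.1 k) == k by rewrite size_mkseq.
  exists (Tuple sp); first by rewrite /= mem_index_enum.
  have TS : T (Tuple sp).
    rewrite -pT ffunE /=; apply/asboolP; exists p.2; first by case: Lp.
    exact: iter_lift_word.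
  rewrite /W TS; split; first split=> //.
    by rewrite /word_set /= (eqP sp).
  by rewrite /preimage /= (eqP sp).
rewrite -sumEFin EFinM -muleA.
apply: (@le_trans _ _ (\sum_(s : k.-tuple bool | T s)
    ((slice_density lambda k)%:E * lebesgue_measure (cell k T : set (measurableTypeR R))))%E).
  rewrite [leRHS]big_mkcond /=; apply: lee_sum => s _.
  rewrite /W; case: ifP => _; last by rewrite /prob measure0.
  rewrite probE; last by apply: measurable_slice => //; exact: (measurable_cell T).
  rewrite -[in slice_density _ k](size_tuple s).
  exact: (slice_le_lebesgue lambda_bounds n0 lambdaXn mLambda LambdaB inv muLambda
    uniform s (measurable_cell T)).
rewrite -sum1_card natr_sum -sumEFin ge0_sume_distrl; last by move=> s _; rewrite lee_fin.
by rewrite le_eqVlt; apply/orP; left; apply/eqP; apply: eq_bigr => s _; rewrite mul1e.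
Qed.

Let I (k : nat) : R :=
  \int[mu]_(p in lift_space Lambda) ln (overlap_count phi Lambda k p.1 p.2)%:R.

Lemma overlap_integralE (k : nat) : I k =
  \sum_(T : {ffun k.-tuple bool -> bool})
    ln (card_of T)%:R * law mu (orbit_covering k) T.
Proof.
have mL := measurable_lift_space mLambda.
rewrite /I.
under eq_Rintegral => p _ do rewrite overlap_countE.
rewrite (Rintegral_discrete mu (X := orbit_covering k)
  (h := fun T : {ffun k.-tuple bool -> bool} => ln (card_of T)%:R))//.
- apply: eq_bigr => T _; rewrite setIC prob_lift_space//.
  exact: discrete_orbit_covering.
- exact: discrete_orbit_covering.
- move=> T; have [->|T0] := posnP (card_of T); first by rewrite ln0.
  by rewrite ln_ge0// ler1n.
Qed.

Lemma overlap_integral_le (k : nat) : I k <= k%:R * ln (2 * lambda) + ln (B + 2).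
Proof.
case/andP: lambda_bounds => l0 l1.
have B0 : 0 <= B.
  by have [_ [x /LambdaB + _]] := Lambda_limit; exact: le_trans.
have l2 : 1 <= 2 * lambda.
  rewrite -(ler_pM2l (_ : 0 < 2^-1)) ?invr_gt0// mulr1 mulKf// -lambdaXn.
  by rewrite -[leRHS]expr1 ler_wiXn2l ?(ltW l0) ?(ltW l1).
have M0 : 0 < (2 * lambda) ^+ k by rewrite exprn_gt0// mulr_gt0.
have M1 : 1 <= (2 * lambda) ^+ k by rewrite exprn_ege1.
have B2 : 0 < B + 2 by lra.
have -> : k%:R * ln (2 * lambda) + ln (B + 2) = ln ((B + 2) * (2 * lambda) ^+ k).
  by rewrite [RHS]lnM ?posrE// lnXn ?mulr_gt0// mulr_natl addrC.
set c := ln _; rewrite overlap_integralE.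
have <- : \sum_T c * law mu (orbit_covering k) T = c.
  by rewrite -mulr_sumr law_sum1 ?mulr1//; exact: discrete_orbit_covering.
apply: ler_sum => T _.
(* The cardinality bound holds only for sets [T] that are attained; the others have law zero. *)
have [[p pT]|nT] := pselect (exists p, orbit_covering k p = T); last first.
  rewrite /law (_ : _ @^-1` _ = set0) /prob ?measure0 ?mulr0//.
  by rewrite -subset0 => p pT; apply: nT; exists p.
rewrite ler_wpM2r ?law_ge0//.
have cT : (card_of T)%:R <= (B + 2) * (2 * lambda) ^+ k.
  by rewrite -pT; exact: (covering_card_le lambda_bounds n0 lambdaXn Lambda_limit LambdaB).
have [->|T0] := posnP (card_of T).
  by rewrite ln0// /c ln_ge0// mulr_ege1//; lra.
by rewrite /c ler_ln ?posrE ?ltr0n// mulr_gt0.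
Qed.

(* From [ln (t / M) >= 1 - M / t] the integral is bounded below in terms of the
integral of the inverse of the count, and there each cell contributes at most its
Lebesgue measure, up to a constant: the count cancels the number of slices meeting
the cell. *)
Lemma overlap_integral_ge (k : nat) : k%:R * ln (2 * lambda) + 1 - B / 2 <= I k.
Proof.
case/andP: lambda_bounds => l0 l1.
have M0 : 0 < (2 * lambda) ^+ k by rewrite exprn_gt0// mulr_gt0.
have -> : k%:R * ln (2 * lambda) = ln ((2 * lambda) ^+ k).
  by rewrite lnXn ?mulr_gt0// mulr_natl.
rewrite overlap_integralE; set M := (2 * lambda) ^+ k in M0 *.
pose leb (T : {ffun k.-tuple bool -> bool}) : R :=
  fine (lebesgue_measure (cell k T : set (measurableTypeR R))).
have lebE (T : {ffun k.-tuple bool -> bool}) : (0 < card_of T)%N ->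
    (leb T)%:E = lebesgue_measure (cell k T : set (measurableTypeR R)).
  move=> T0; rewrite /leb fineK// ge0_fin_numE ?measure_ge0//.
  apply: le_lt_trans (ltry (2 * B)); apply: le_trans (sum_lebesgue_cell k).
  by rewrite (bigD1 T)//= leeDl// sume_ge0// => *; exact: measure_ge0.
have sum_leb : \sum_(T : {ffun k.-tuple bool -> bool} | (0 < card_of T)%N) leb T <= 2 * B.
  rewrite -lee_fin -sumEFin (le_trans _ (sum_lebesgue_cell k))//.
  by rewrite le_eqVlt; apply/orP; left; apply/eqP; apply: eq_bigr => T /lebE.
have sum_law : \sum_T law mu (orbit_covering k) T = 1.
  by rewrite law_sum1//; exact: discrete_orbit_covering.
apply: (@le_trans _ _ (\sum_(T : {ffun k.-tuple bool -> bool})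
    ((ln M + 1) * law mu (orbit_covering k) T -
     (if (0 < card_of T)%N then 4^-1 * leb T else 0)))).
  rewrite sumrB -mulr_sumr sum_law mulr1 -big_mkcond /= -mulr_sumr.
  rewrite lerD2l lerN2; apply: (@le_trans _ _ (4^-1 * (2 * B))).
    by rewrite ler_wpM2l// invr_ge0.
  by rewrite le_eqVlt; apply/orP; left; apply/eqP; field.
apply: ler_sum => T _; have lT := law_covering_le T.
have [T0|T0] := posnP (card_of T).
  move: lT; rewrite T0 mulr0n !mul0r mul0e lee_fin => lT.
  have -> : law mu (orbit_covering k) T = 0 by apply/le_anti; rewrite lT law_ge0.
  by rewrite !mulr0 subr0.
have T0R : 0 < (card_of T)%:R :> R by rewrite ltr0n.
move: lT; rewrite -lebE// -EFinM lee_fin => lT.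
set q := law _ _ _ in lT *; set t : R := (card_of T)%:R in lT T0R *.
have q0 : 0 <= q by exact: law_ge0.
(* This is [ln_gibbs] at [t] and [M], divided by [t]. *)
have lnt : ln M + 1 - M / t <= ln t.
  have := ln_gibbs (ltW T0R) (ltW M0) (fun _ => M0).
  rewrite -mulrBr mulrC -ler_pdivlMr// mulrBl divff ?gt_eqF//; lra.
(* The factor [t] from the number of slices cancels against [M / t], and [M] against the slice
   density, leaving [1/4]. *)
have qM : q * (M / t) <= 4^-1 * leb T.
  have -> : 4^-1 * leb T = t * slice_density lambda k * leb T * (M / t).
    by rewrite /slice_density -/M; field; rewrite !gt_eqF//.
  by rewrite ler_wpM2r// divr_ge0 ?ltW.
apply: (@le_trans _ _ (q * (ln M + 1 - M / t))).
  by rewrite mulrBr [q * _]mulrC lerD2l lerN2.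
by rewrite [ln t * q]mulrC ler_wpM2l.
Qed.

(** The two bounds on the integral differ from [k * ln (2 * lambda)] by constants independent of
    [k]. *)
Lemma cvg_overlap_average :
  overlap_average phi Lambda mu @ \oo --> ln (2 * lambda).
Proof.
apply/cvgrPdist_le => e e0.
near=> k.
have k0 : (0 < k)%N by near: k; exact: nbhs_infty_gt.
have k0R : 0 < k%:R :> R by rewrite ltr0n.
have ke : (`|ln (B + 2)| + `|1 - B / 2|) <= e * k%:R.
  rewrite [leRHS]mulrC -ler_pdivrMr//; near: k; exact: nbhs_infty_ger.
rewrite /overlap_average -/(I k).
rewrite (_ : ln _ - _ = k%:R^-1 * (k%:R * ln (2 * lambda) - I k)); last first.
  by rewrite mulrBr mulKf// gt_eqF.
rewrite normrM gtr0_norm ?invr_gt0// ler_pdivrMl// [leRHS]mulrC.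
apply: le_trans ke; have := overlap_integral_le k; have := overlap_integral_ge k.
have := ler_norm (ln (B + 2)); have := ler_norm (- (1 - B / 2)); rewrite normrN.
have := normr_ge0 (ln (B + 2)); have := normr_ge0 (1 - B / 2).
move=> *; rewrite ler_norml; apply/andP; split; lra.
Unshelve. all: by end_near. Qed.

End overlap_bounds.

Unset Implicit Arguments.
Set Strict Implicit.

Theorem corollary1 (R : realType) (n : nat) (hn : (1 <= n)%N)
  (lambda : R) (hlambda : lambda = 2 `^ (- n%:R^-1))
  (Lambda : set R) (hLambda : limit_set (bernoulli_ifs lambda) Lambda)
  (mu_max : probability (shift_space * measurableTypeR R)%type R)
  (hmu_max : max_entropy_measure (lift_map (bernoulli_ifs lambda))
               (lift_space Lambda) mu_max) :
  [/\ cvgn (overlap_average (bernoulli_ifs lambda) Lambda mu_max),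
      overlap_number (bernoulli_ifs lambda) Lambda mu_max
        = (2 ^+ (n - 1)) `^ (n%:R^-1)
    & pushforward mu_max snd `<< (@lebesgue_measure R)].
Proof.
have nR0 : n%:R != 0 :> R by rewrite pnatr_eq0 -lt0n.
have l0 : 0 < lambda by rewrite hlambda powR_gt0.
have lambdaXn : lambda ^+ n = 2^-1.
  by rewrite hlambda -powR_mulrn ?powR_ge0// -powRrM mulNr mulVf// powR_inv1.
have l1 : lambda < 1.
  rewrite ltNge; apply/negP => /(exprn_ege1 n).
  by rewrite lambdaXn; lra.
have lb : 0 < lambda < 1 by rewrite l0.
have [cL _ _] := hLambda.
have [B LambdaB] : exists B, forall x, Lambda x -> `|x| <= B.
  have [M [_ HM]] := compact_bounded cL.
  by exists (M + 1) => x Lx; apply: HM Lx; rewrite ltrDl.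
have uniform := max_entropy_letters lb hLambda hmu_max.
have [[muL inv] _] := hmu_max.
have mL := measurable_limit_set hLambda.
have cvgo := cvg_overlap_average lb hn lambdaXn hLambda LambdaB inv muL uniform.
split.
- by apply/cvg_ex; eexists; exact: cvgo.
(* Both sides are the power of 2 with exponent [1 - 1 / n], the left one in the form
   [2 * lambda]. *)
- rewrite /overlap_number (cvg_lim _ cvgo)// lnK ?posrE ?mulr_gt0//.
  rewrite -powR_mulrn// -powRrM natrB// mulrBl divff// mul1r hlambda.
  by rewrite powRD ?powRr1//; apply/implyP.
- exact: (pushforward_snd_dominated lb hn lambdaXn mL LambdaB inv muL uniform).
Qed.
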